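(* Let $(X,d,\mathfrak m)$ be a metric measure space and let $\mathscr A$ be a unital separating subalgebra of $\mathrm{LIP}_\star(X)$. Then $\mathrm{BV}_{\rm W}(X;\mathscr A)\subseteq \mathrm{BV}_{\rm H}(X;\mathscr A)$ and $$\|\mathbf D f\|_{*,\mathscr A}\le |\mathbf D f|_{\mathscr A}(X)\qquad\text{for every } f\in \mathrm{BV}_{\rm W}(X;\mathscr A).$$
   Context: **Metric measure spaces and Lipschitz algebras.** A metric measure space is a triple $(X,d,\mathfrak m)$ where $(X,d)$ is a metric space (not assumed complete or separable) and $\mathfrak m\ge 0$ is a finite Radon measure on $X$ (a finite Borel measure that is inner regular with respect to compact sets). $\mathcal M(X)$ is the Banach space of finite signed Radon measures on $X$ with the total variation norm; $|\mu|$ is the total variation measure of $\mu$. The support is $\mathrm{spt}(\mathfrak m)=\{x: \mathfrak m(B_r(x))>0\ \forall r>0\}$, with $B_r(x)$ the open ball. For $f:X\to\mathbb R$ and $E\subseteq X$ let $\mathrm{Lip}(f;E)=\sup\{|f(x)-f(y)|/d(x,y): x,y\in E,\ x\ne y\}\in[0,\infty]$ ($\sup\varnothing=0$). $\mathrm{LIP}_{loc}(X)$ is the set of continuous $f:X\to\mathbb R$ with $\inf_{r>0}\mathrm{Lip}(f;B_r(x))<\infty$ for all $x\in X$; the asymptotic slope of such $f$ is $\mathrm{lip}_a(f)(x)=\inf_{r>0}\mathrm{Lip}(f;B_r(x))$. $\mathrm{LIP}_\star(X)$ is the algebra of bounded functions $f\in\mathrm{LIP}_{loc}(X)$ with $\mathrm{lip}_a(f)\in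 L^1(\mathfrak m)$. A subalgebra $\mathscr A$ is unital if it contains the constant function $1$, and separating if for all $x\ne y$ in $X$ there is $f\in\mathscr A$ with $f(x)\ne f(y)$. **$\mathrm{BV}_{\rm H}$.** $\mathrm{BV}_{\rm H}(X;\mathscr A)$ is the set of $f\in L^1(\mathfrak m)$ for which there is $(f_n)_n\subseteq\mathscr A$ with $f_n\to f$ in $L^1(\mathfrak m)$ and $\sup_n\int \mathrm{lip}_a(f_n)\,d\mathfrak m<\infty$. For such $f$, $\|\mathbf Df\|_{*,\mathscr A}=\inf\{\liminf_n\int\mathrm{lip}_a(f_n)\,d\mathfrak m : (f_n)_n\subseteq\mathscr A,\ f_n\to f\text{ in }L^1(\mathfrak m)\}$. **Derivations.** $\mathrm{Der}^\infty(X;\mathscr A)$ is the set of linear maps $b:\mathscr A\to L^1(\mathfrak m)$ with $b(fg)=f\,b(g)+g\,b(f)$ for all $f,g\in\mathscr A$, and for which there is $G\in L^\infty(\mathfrak m)$, $G\ge0$, with $|b(f)|\le G\,\mathrm{lip}_a(f)$ $\mathfrak m$-a.e. for every $f\in\mathscr A$; the $\mathfrak m$-a.e. minimal such $G$ is denoted $|b|_{\mathscr A}$. The norm of $b$ is $\||b|_{\mathscr A}\|_{L^\infty(\mathfrak m)}$. $\mathrm{Der}^\infty_\infty(X;\mathscr A)$ is the subspace of those $b$ for which there is a (unique) $\mathrm{div}(b)\in L^\infty(\mathfrak m)$ with $\int b(f)\,d\mathfrak m=-\int f\,\mathrm{div}(b)\,d\mathfrak m$ for all $f\in\mathscr A$.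 It is an $\mathscr A$-module via $(hb)(f)=h\,b(f)$. **$\mathrm{BV}_{\rm W}$.** $\mathrm{BV}_{\rm W}(X;\mathscr A)$ is the set of $f\in L^1(\mathfrak m)$ for which there is a bounded linear operator $\mathbf L_f:\mathrm{Der}^\infty_\infty(X;\mathscr A)\to\mathcal M(X)$ such that, for all $b\in\mathrm{Der}^\infty_\infty(X;\mathscr A)$ and $h\in\mathscr A$: $\mathbf L_f(b)(X)=-\int f\,\mathrm{div}(b)\,d\mathfrak m$; $\mathbf L_f(hb)=h\,\mathbf L_f(b)$; $|\mathbf L_f(b)|(X\setminus\mathrm{spt}(\mathfrak m))=0$. Such $\mathbf L_f$ is unique. The total $\mathscr A$-variation measure is $|\mathbf Df|_{\mathscr A}=\bigvee\{|\mathbf L_f(b)| : b\in\mathrm{Der}^\infty_\infty(X;\mathscr A),\ |b|_{\mathscr A}\le1\ \mathfrak m\text{-a.e.}\}$, where for a set $\mathrm M$ of non-negative Borel measures, $\bigvee\mathrm M(E)=\sup\{\sum_n\mu_n(E_n): (\mu_n)_{n\in\mathbb N}\subseteq\mathrm M,\ (E_n)_{n\in\mathbb N}\text{ Borel partition of }E\}$ is the supremum measure. *)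

(* Defs.v *)
From HB Require Import structures.
From mathcomp Require Import all_boot all_order all_algebra.
From mathcomp Require Import all_classical all_reals all_analysis.

Set Implicit Arguments.
Unset Strict Implicit.
Unset Printing Implicit Defensive.

Import Order.TTheory GRing.Theory Num.Theory.
Import numFieldNormedType.Exports.

Local Open Scope classical_set_scope.
Local Open Scope ring_scope.

(* Measurable types of the library are pointed, so metric spaces are taken
   with a base point, i.e. nonempty. *)
#[short(type="pmetricType")]
HB.structure Definition PointedMetric (K : numDomainType) :=
  {M of Pointed M & Metric K M}.

Notation borel X := (g_sigma_algebraType (@open X)).

Section lipschitz.
Context {R : realType} {X : pmetricType R}.
Implicit Types (f : X -> R) (E : set X).

(* Joining [0] makes the supremum over an empty set equal to 0 instead of -oo;
   all difference quotients are nonnegative. *)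
Definition Lip f E : \bar R :=
  ereal_sup (0%E |` [set (`|f p.1 - f p.2| / mdist p.1 p.2)%:E | p in
    [set p : X * X | E p.1 /\ E p.2 /\ p.1 <> p.2]]).

Definition lip_a f (x : X) : \bar R :=
  ereal_inf [set Lip f (ball x r) | r in [set r : R | 0 < r]].

Definition LIP_loc : set (X -> R) :=
  [set f | continuous f /\ forall x, (lip_a f x < +oo)%E].

End lipschitz.

Section measures.
Context {R : realType} {X : pmetricType R}.
Local Open Scope ereal_scope.

Definition radon (m : set (borel X) -> \bar R) :=
  forall E : set (borel X), measurable E ->
    m E = ereal_sup [set m K | K in
      [set K : set (borel X) | @compact X K /\ K `<=` E]].

Definition spt (m : set (borel X) -> \bar R) : set (borel X) :=
  [set x : X | forall r : R, (0 < r)%R -> 0 < m (ball x r)].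

Lemma hahn_sig (nu : {charge set (borel X) -> \bar R}) :
  {PN : set (borel X) * set (borel X) | hahn_decomposition nu PN.1 PN.2}.
Proof.
by apply: cid; have [P [N PN]] := Hahn_decomposition nu; exists (P, N).
Qed.

(* The values on measurable sets do not depend on the Hahn decomposition that
   is picked, by [Hahn_decomposition_uniq]. *)
Definition tvar (nu : {charge set (borel X) -> \bar R}) :=
  charge_variation (svalP (hahn_sig nu)).

(* [int_charge nu h] is the set function $E \mapsto \int_E h\,d\nu$, i.e. the
   signed measure $h\nu$. *)
Definition int_charge (nu : {charge set (borel X) -> \bar R}) (h : X -> R)
    (E : set (borel X)) : \bar R :=
  \int[jordan_pos (svalP (hahn_sig nu))]_(x in E) (h x)%:E -
  \int[jordan_neg (svalP (hahn_sig nu))]_(x in E) (h x)%:E.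

Definition sup_measure (M : set (set (borel X) -> \bar R))
    (E : set (borel X)) : \bar R :=
  ereal_sup [set s | exists (mu_ : nat -> set (borel X) -> \bar R)
                            (F : (set (borel X))^nat),
    [/\ forall n, M (mu_ n), forall n, measurable (F n), trivIset setT F,
        \bigcup_n F n = E & s = \sum_(n <oo) mu_ n (F n)]].

End measures.

Section BV.
Context {R : realType} {X : pmetricType R}.
Variable m : {finite_measure set (borel X) -> \bar R}.
Implicit Types (A : set (X -> R)) (f G D : X -> R) (b : (X -> R) -> X -> R).

Definition LIP_star : set (X -> R) :=
  [set f | [/\ LIP_loc f, bounded_fun f & m.-integrable setT (lip_a f)]].

(* The library has no lalgType instance on functions, hence no [subalg_closed]. *)
Definition unital_subalgebra A := submod_closed (mem A) /\ mulr_closed (mem A).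

Definition separating A := forall x y : X, x <> y -> exists2 f, A f & f x <> f y.

Definition cvg_L1 (u : (X -> R)^nat) f :=
  ('N[m]_1[EFin \o (u n \- f)%R])%E @[n --> \oo] --> 0%E.

Definition BV_H A : set (X -> R) :=
  [set f | f \in Lfun m 1 /\ exists u : (X -> R)^nat,
    [/\ forall n, A (u n), cvg_L1 u f &
        (ereal_sup (range (fun n => \int[m]_x lip_a (u n) x)%E) < +oo)%E]].

Definition BV_H_norm A f : \bar R :=
  ereal_inf [set l | exists u : (X -> R)^nat,
    [/\ forall n, A (u n), cvg_L1 u f &
        l = limn_einf (fun n => \int[m]_x lip_a (u n) x)%E]].

(* A map from A to $L^1(m)$ is represented by a function b whose values outside
   A are irrelevant and whose values on A are integrable functions taken up to
   m-a.e. equality. *)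
Definition der_bound A b G :=
  [/\ G \in Lfun m +oo, \forall x \ae m, 0 <= G x &
      forall f, A f -> \forall x \ae m, (`|b f x|%:E <= (G x)%:E * lip_a f x)%E].

Definition Der A b :=
  [/\ forall f, A f -> b f \in Lfun m 1,
      forall a f g, A f -> A g -> b (a *: f + g) = a *: b f + b g %[ae m],
      forall f g, A f -> A g -> b (f * g) = f * b g + g * b f %[ae m] &
      exists G, der_bound A b G].

(* G is (a representative of) the minimal function $|b|_A$; it is unique m-a.e.,
   and exists for every b in [Der A] since m is finite. *)
Definition der_modulus A b G :=
  der_bound A b G /\
  forall G', der_bound A b G' -> \forall x \ae m, G x <= G' x.

Definition is_div A b D :=
  D \in Lfun m +oo /\ forall f, A f ->
    (\int[m]_x (b f x)%:E = - \int[m]_x (f x * D x)%:E)%E.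

Definition Der_div A b := Der A b /\ exists D, is_div A b D.

(* Only the values of L on Der_div matter. Linearity and boundedness force L to
   agree on derivations that agree m-a.e. on A. Since $\mathrm{div}(hb) =
   h\,\mathrm{div}(b) + b(h)$ and $\mathrm{lip}_a(h)$ is only integrable, hb may
   leave Der_div for some h in A; A-linearity is required whenever both sides
   are defined. *)
Definition BV_W_op A f (L : ((X -> R) -> X -> R) ->
    {charge set (borel X) -> \bar R}) :=
  [/\ forall b, Der_div A b -> radon (tvar (L b)),
      forall a b c, Der_div A b -> Der_div A c ->
        forall E, measurable E ->
        (L (fun g => a *: b g + c g)%R E = a%:E * L b E + L c E)%E,
      exists C : R, forall b G, Der_div A b -> der_modulus A b G ->
        (tvar (L b) setT <= C%:E * 'N[m]_+oo[EFin \o G])%E &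
      forall b, Der_div A b ->
      [/\ forall D, is_div A b D ->
            (L b setT = - \int[m]_x (f x * D x)%:E)%E,
          forall h, A h -> Der_div A (fun g => h * b g) ->
            forall E, measurable E ->
            L (fun g => h * b g) E = int_charge (L b) h E &
          tvar (L b) (~` spt m) = 0%E]].

Definition BV_W A : set (X -> R) :=
  [set f | f \in Lfun m 1 /\ exists L, BV_W_op A f L].

(* The total variation measure $|Df|_A$, in terms of the operator of f. *)
Definition total_variation_W A (L : ((X -> R) -> X -> R) ->
    {charge set (borel X) -> \bar R}) : set (borel X) -> \bar R :=
  sup_measure [set nu : set (borel X) -> \bar R | exists b G,
    [/\ Der_div A b, der_modulus A b G, \forall x \ae m, G x <= 1 &
        nu = tvar (L b)]].

End BV.

(* Main.v *)
Require Import Defs.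
From HB Require Import structures.
From mathcomp Require Import all_boot all_order all_algebra.
From mathcomp Require Import finmap.
From mathcomp Require Import all_classical all_reals all_analysis.
From mathcomp Require Import measurable_realfun ess_sup_inf ring lra.

Set Implicit Arguments.
Unset Strict Implicit.
Unset Printing Implicit Defensive.

Import Order.TTheory GRing.Theory Num.Theory.
Import numFieldNormedType.Exports.

Local Open Scope classical_set_scope.
Local Open Scope ring_scope.

(* For $\lambda > 0$ put
   $q_\lambda(f) = \inf_{u \in A} \int lip_a(u) dm + \lambda \|f - u\|_1$.
   If $q_\lambda(f)$ is bounded by $S$ for all $\lambda$, then almost minimal u
   for $\lambda = n + 1$ form a sequence converging to f in $L^1$ whose energies
   are at most $S + \varepsilon$. So it suffices to find a derivation b with
   $|b| \le 1$ and $q_\lambda(f) = - \int f div(b) dm$, because the right-hand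
   side is $L_f(b)(X) \le |L_f(b)|(X)$.

   Consider pairs $(\omega, v)$ with $v \in L^1$ and $\omega$ a field
   $x \mapsto \omega(x)$ of functions, thought of as the 1-form
   $x \mapsto d_x(\omega(x))$, with the seminorm
   $\inf_{u \in A} \int lip_a(\omega(x) + u)(x) dm(x) + \lambda \|v - u\|_1$.
   The Hahn-Banach theorem gives a dominated linear functional $\Lambda$ with
   $\Lambda(0, f) = q_\lambda(f)$. By duality $\Lambda(0, v) = \int v g dm$ with
   $|g| \le \lambda$, and $\Lambda(h \otimes u, 0) = \int h b(u) dm$ with
   $|b(u)| \le lip_a(u)$. The seminorm vanishes on $(u, -u)$ for u in A, which
   says $div(b) = -g$. The Leibniz rule holds because
   $lip_a(uv - u(x) v - v(x) u)(x) = 0$. *)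

(** * The Hahn-Banach theorem *)

Section hahn_banach.
Context {R : realType} {V : lmodType R}.
Variable D : set V.
Hypothesis D0 : D 0.
Hypothesis DD : forall x y, D x -> D y -> D (x + y).
Hypothesis DZ : forall a x, D x -> D (a *: x).
Implicit Types (p q : V -> R) (x y : V).

Definition sublinear_on q := [/\ q 0 = 0,
  forall x y, D x -> D y -> q (x + y) <= q x + q y &
  forall x t, D x -> 0 < t -> q (t *: x) <= t * q x].

Let DN x : D x -> D (- x). Proof. by rewrite -scaleN1r; exact: DZ. Qed.

(** The reverse inequality comes from the hypothesis at [t^-1] and [t *: x]. *)
Lemma sublinearZ q x t : sublinear_on q -> D x -> 0 <= t -> q (t *: x) = t * q x.
Proof.
move=> [q0 _ qZ] Dx; rewrite le_eqVlt => /predU1P[<-|t0].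
  by rewrite scale0r mul0r.
apply/eqP; rewrite eq_le qZ //= -ler_pdivlMl//.
rewrite -{1}[x]scale1r -(@mulVf _ t) ?gt_eqF// -scalerA.
by rewrite qZ ?invr_gt0//; exact: DZ.
Qed.

Lemma sublinear_geN q x : sublinear_on q -> D x -> - q (- x) <= q x.
Proof.
move=> [q0 qD _] Dx; have := qD _ _ Dx (DN Dx).
by rewrite subrr q0; lra.
Qed.

(* The infimum over [t] bends [q] into a smaller sublinear function that is
   additive along [y]; hence a minimal sublinear function is linear. *)
Definition directional q y x := inf [set q (x + t *: y) - t * q y | t in [set t | 0 <= t]].

Section directional.
Variables (q : V -> R) (y : V).
Hypotheses (qsub : sublinear_on q) (Dy : D y).

(** The infimum defining [directional] is finite, by subadditivity applied to
    [t *: y = (x + t *: y) + (- x)]. *)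
Let dirE x : D x -> lbound [set q (x + t *: y) - t * q y | t in [set t | 0 <= t]] (- q (- x)).
Proof.
move=> Dx _ [t /= t0 <-]; rewrite -(sublinearZ qsub Dy t0).
have [_ qD _] := qsub.
have := qD _ _ (DD Dx (DZ t Dy)) (DN Dx).
by rewrite addrAC subrr add0r; lra.
Qed.

Let dir_nonempty x : [set q (x + t *: y) - t * q y | t in [set t | 0 <= t]] !=set0.
Proof. by exists (q (x + 0 *: y) - 0 * q y), 0 => /=. Qed.

Lemma directional_le x t : D x -> 0 <= t -> directional q y x <= q (x + t *: y) - t * q y.
Proof.
by move=> Dx t0; apply: ge_inf; [exists (- q (- x)); exact: dirE|exists t].
Qed.

Lemma le_directional x c :
  (forall t, 0 <= t -> c <= q (x + t *: y) - t * q y) -> c <= directional q y x.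
Proof.
by move=> H; apply: lb_le_inf; [exact: dir_nonempty|move=> _ [t t0 <-]; exact: H].
Qed.

Lemma sublinear_directional : sublinear_on (directional q y).
Proof.
have [q0 qD qZ] := qsub; split.
- apply/eqP; rewrite eq_le; apply/andP; split.
    by have := @directional_le 0 0 D0 (lexx _); rewrite scale0r addr0 q0 mul0r subr0.
  by apply: le_directional => t t0; rewrite add0r sublinearZ// subrr.
(* Parameters [s] for [z] and [t] for [x] are merged into the single parameter [t + s] for
   [x + z]. *)
- move=> x z Dx Dz; rewrite -lerBlDl.
  apply: le_directional => s s0; rewrite lerBlDl -lerBlDr.
  apply: le_directional => t t0; rewrite lerBlDr.
  have := directional_le (DD Dx Dz) (addr_ge0 t0 s0).
  have := qD _ _ (DD Dx (DZ t Dy)) (DD Dz (DZ s Dy)).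
  by rewrite addrACA -scalerDl mulrDl; lra.
- move=> x t Dx t0; rewrite -ler_pdivrMl//; apply: le_directional => s s0.
  rewrite ler_pdivrMl// (le_trans (directional_le (DZ t Dx) (mulr_ge0 (ltW t0) s0)))//.
  by rewrite -scalerA -scalerDr mulrBr -mulrA lerD2r qZ//; exact/DD/DZ.
Qed.

Lemma directional_ge x : D x -> directional q y x <= q x.
Proof.
by move=> Dx; have := directional_le Dx (lexx 0); rewrite scale0r addr0 mul0r subr0.
Qed.

(** The choice [t = 1]. A sublinear [q] that cannot be lowered on [D] thus satisfies
    [q (- y) <= - q y], which makes it odd. *)
Lemma directionalN : directional q y (- y) <= - q y.
Proof.
have [q0 _ _] := qsub.
have := directional_le (DN Dy) ler01.
by rewrite scale1r addNr q0 mul1r add0r.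
Qed.

End directional.

(** Zorn's lemma on the sublinear functions below [p], larger meaning pointwise smaller. Functions
    are compared on [D] only, so this is a preorder. A chain is bounded by its pointwise infimum,
    finite because every member is at least [- p (- x)] at [x]. *)
Lemma minimal_sublinear p : sublinear_on p ->
  exists q, [/\ sublinear_on q, forall x, D x -> q x <= p x &
    forall r, sublinear_on r -> (forall x, D x -> r x <= q x) ->
      forall x, D x -> q x <= r x].
Proof.
move=> psub.
pose T := {q : V -> R | sublinear_on q /\ forall x, D x -> q x <= p x}.
pose mk q (qsub : sublinear_on q) (qp : forall x, D x -> q x <= p x) : T :=
  exist _ q (conj qsub qp).
pose r (q q' : T) := `[< forall x, D x -> sval q' x <= sval q x >].
have t0 : T by exists p; split.
have [|||[q [qsub qp]] qmin] := @ZL_preorder T t0 r.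
- by move=> q; apply/asboolP.
- move=> q1 q2 q3 /asboolP h12 /asboolP h23; apply/asboolP => x Dx.
  exact: le_trans (h23 _ Dx) (h12 _ Dx).
- move=> F Ftot; have [->|/set0P[q1 Fq1]] := eqVneq F set0; first by exists t0.
  pose G x := [set sval q x | q in F].
  have Glb x : D x -> lbound (G x) (- p (- x)).
    move=> Dx _ [[q [qsub qp]] _ <-] /=.
    apply: le_trans (sublinear_geN qsub Dx); rewrite lerN2; exact/qp/DN.
  have Gne x : G x !=set0 by exists (sval q1 x), q1.
  have Gle x (q : T) : D x -> F q -> inf (G x) <= sval q x.
    by move=> Dx Fq; apply: ge_inf; [exists (- p (- x)); exact: Glb|exists q].
  have leG x c : (forall q : T, F q -> c <= sval q x) -> c <= inf (G x).
    by move=> H; apply: lb_le_inf => // _ [q Fq <-]; exact: H.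
  have Gsub : sublinear_on (fun x => inf (G x)).
    split.
    + have q0 : forall q : T, sval q 0 = 0 by move=> [q [[]]].
      apply/eqP; rewrite eq_le; apply/andP; split.
        by rewrite -(q0 q1); exact: Gle.
      by apply: leG => q _; rewrite q0.
    + move=> x y Dx Dy; rewrite -lerBlDl.
      apply: (leG _ _) => q Fq; rewrite lerBlDl -lerBlDr.
      apply: leG => q' Fq'; rewrite lerBlDr.
      (* Different members of the chain may be used at [x] and at [y]; the smaller of the two serves
         for both. *)
      have [/asboolP h|/asboolP h] := Ftot _ _ Fq Fq'.
      * apply: le_trans (Gle _ _ (DD Dx Dy) Fq') _.
        case: q' {Fq'} h => q' [[_ q'D _] _] /= h.
        by apply: le_trans (q'D _ _ Dx Dy) _; rewrite lerD2l; exact: h.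
      * apply: le_trans (Gle _ _ (DD Dx Dy) Fq) _.
        case: q {Fq} h => q [[_ qD _] _] /= h.
        by apply: le_trans (qD _ _ Dx Dy) _; rewrite lerD2r; exact: h.
    + move=> x t Dx t0'; rewrite -ler_pdivrMl//.
      apply: leG => q Fq; rewrite ler_pdivrMl//.
      apply: le_trans (Gle _ _ (DZ t Dx) Fq) _.
      by case: q {Fq} => q [[_ _ qZ] _] /=; exact: qZ.
  have Gp x : D x -> inf (G x) <= p x.
    move=> Dx; apply: le_trans (Gle _ _ Dx Fq1) _.
    by case: q1 {Fq1} => q [_ qp] /=; exact: qp.
  exists (mk _ Gsub Gp) => q Fq; apply/asboolP => x Dx /=.
  exact: Gle.
- exists q; split => // s ssub sq x Dx.
  have sp y : D y -> s y <= p y by move=> Dy; exact: le_trans (sq _ Dy) (qp _ Dy).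
  by have /asboolP := qmin (mk _ ssub sp) (asboolT sq); exact.
Qed.

(** A minimal [l] is taken below [directional p x0] instead of [p]: this gives [l (- x0) <= - p x0],
    hence equality at [x0]. Bending [l] along any [x] cannot lower it, so [l] is odd, and an odd
    subadditive function is additive. *)
Theorem hahn_banach p x0 : sublinear_on p -> D x0 ->
  exists l : V -> R, [/\ forall a x y, D x -> D y -> l (a *: x + y) = a * l x + l y,
    forall x, D x -> l x <= p x & l x0 = p x0].
Proof.
move=> psub Dx0.
have [l [lsub lp lmin]] := minimal_sublinear (sublinear_directional psub Dx0).
have lp' x : D x -> l x <= p x.
  by move=> Dx; exact: le_trans (lp _ Dx) (directional_ge psub Dx0 Dx).
have lN x : D x -> l (- x) = - l x.
  move=> Dx; apply/eqP; rewrite eq_le; apply/andP; split; last first.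
    by have := sublinear_geN lsub Dx; rewrite lerNl.
  apply: le_trans (directionalN lsub Dx).
  apply: lmin (DN Dx); first exact: sublinear_directional.
  by move=> y; exact: directional_ge.
have [l0 lD _] := lsub.
have lD' x y : D x -> D y -> l (x + y) = l x + l y.
  move=> Dx Dy; apply/eqP; rewrite eq_le lD//=.
  by have := lD _ _ (DD Dx Dy) (DN Dy); rewrite addrK lN//; lra.
exists l; split => //.
- move=> a x y Dx Dy; rewrite lD'//; last exact: DZ.
  congr (_ + _); have [a0|a0] := leP 0 a; first exact: sublinearZ.
  rewrite -[a]opprK scaleNr lN; last exact: DZ.
  by rewrite (sublinearZ lsub Dx) ?mulNr// oppr_ge0 ltW.
- apply/eqP; rewrite eq_le lp'//=.
  have := le_trans (lp _ (DN Dx0)) (directionalN psub Dx0).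
  by rewrite lN// lerN2.
Qed.

End hahn_banach.

(** [C x c] reads as: [c] is an admissible upper bound for the seminorm of [x]. The seminorm is the
    infimum of these bounds, and it is considered only at the [x] that have one. *)
Lemma hahn_banach_gauge {R : realType} {V : lmodType R} (C : V -> R -> Prop) (x0 : V) c0 :
  (forall x c, C x c -> 0 <= c) ->  C 0 0 ->
  (forall x y c d, C x c -> C y d -> C (x + y) (c + d)) ->
  (forall a x c, C x c -> C (a *: x) (`|a| * c)) ->
  C x0 c0 ->
  exists l : V -> R,
  [/\ forall a x y c d, C x c -> C y d -> l (a *: x + y) = a * l x + l y,
      forall x c, C x c -> `|l x| <= c & l x0 = inf [set c | C x0 c]].
Proof.
move=> Cge0 C0 CD CZ Cx0.
pose D := [set x | exists c, C x c].
have [|||||] := @hahn_banach R V D _ _ _ (fun x => inf [set c | C x c]) x0.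
- by exists 0.
- by move=> x y [c xc] [d yd]; exists (c + d); exact: CD.
- by move=> a x [c xc]; exists (`|a| * c); exact: CZ.
- have ple x c : C x c -> inf [set c | C x c] <= c.
    by move=> xc; apply: ge_inf => //; exists 0 => d; exact: Cge0.
  have lep x c : D x -> (forall d, C x d -> c <= d) -> c <= inf [set c | C x c].
    by move=> [d xd] H; apply: lb_le_inf; [exists d|].
  split.
  + apply/eqP; rewrite eq_le ple//=; apply: lep; first by exists 0.
    exact: Cge0.
  + move=> x y Dx Dy; rewrite -lerBlDl.
    apply: (lep _ _) => // d yd; rewrite lerBlDl -lerBlDr.
    apply: lep => // c xc; rewrite lerBlDr; exact/ple/CD.
  + move=> x t Dx t0; rewrite -ler_pdivrMl//; apply: lep => // c xc.
    by rewrite ler_pdivrMl// ple// -{2}(gtr0_norm t0); exact: CZ.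
- by exists c0.
- move=> l [lin lp lx0]; exists l; split => //.
  + by move=> a x y c d xc yd; apply: lin; [exists c|exists d].
  + have lle x c : C x c -> l x <= c.
      move=> xc; apply: le_trans (lp _ _) _; first by exists c.
      by apply: ge_inf => //; exists 0 => d; exact: Cge0.
    have D0 : D 0 by exists 0.
    have l0 : l 0 = 0.
      by have := lin 1 0 0 D0 D0; rewrite scale1r addr0 mul1r; lra.
    move=> x c xc; rewrite ler_norml lle// andbT lerNl.
    have := lin (-1) x 0 (ex_intro _ c xc) D0.
    rewrite addr0 l0 addr0 mulN1r => <-; apply: lle.
    by have := CZ (-1) x c xc; rewrite normrN1 mul1r.
Qed.

(** * Duality for weighted L1 spaces *)

Section integrable_real.
Context {d} {T : measurableType d} {R : realType}.
Variable mu : {measure set T -> \bar R}.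
Implicit Types h k : T -> R.
Local Notation integrable1 h := (mu.-integrable [set: T] (EFin \o h)).

Lemma integrable1_measurable h : integrable1 h -> measurable_fun setT h.
Proof. by move=> ih; exact/measurable_EFinP/(measurable_int mu). Qed.

Lemma EFin_Rintegral h : integrable1 h ->
  (\int[mu]_x (h x)%:E)%E = (\int[mu]_x h x)%:E.
Proof. by move=> ih; rewrite /Rintegral fineK// integrable_fin_num. Qed.

Lemma integrable1_norm h : integrable1 h -> integrable1 (fun x => `|h x|).
Proof. by move=> ih; apply: eq_integrable (integrable_abse ih). Qed.

Lemma integrable1D h k : integrable1 h -> integrable1 k ->
  integrable1 (fun x => h x + k x).
Proof.
by move=> ih ik; apply: eq_integrable (integrableD measurableT ih ik).
Qed.

Lemma integrable1B h k : integrable1 h -> integrable1 k ->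
  integrable1 (fun x => h x - k x).
Proof.
by move=> ih ik; apply: eq_integrable (integrableB measurableT ih ik).
Qed.

Lemma integrable1Z a h : integrable1 h -> integrable1 (fun x => a * h x).
Proof.
by move=> ih; apply: eq_integrable (integrableZl measurableT a ih).
Qed.

Lemma integrable1_mulr_bounded h k c : integrable1 h ->
  measurable_fun setT k -> (forall x, `|k x| <= c) -> integrable1 (fun x => k x * h x).
Proof.
move=> ih mk kc; apply: le_integrable (integrable1Z c ih) => //.
  apply/measurable_EFinP; apply: measurable_funM => //.
  exact: integrable1_measurable.
move=> x _ /=; rewrite lee_fin !normrM ler_wpM2r//.
by rewrite (le_trans (kc x))// ler_norm.
Qed.

End integrable_real.

Lemma integrable1_bounded {d} {T : measurableType d} {R : realType}
    (mu : {finite_measure set T -> \bar R}) (h : T -> R) c :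
  measurable_fun setT h -> (forall x, `|h x| <= c) -> mu.-integrable setT (EFin \o h).
Proof.
move=> mh hc; have i1 : mu.-integrable setT (EFin \o (cst 1 : T -> R)).
  exact: finite_measure_integrable_cst.
apply: eq_integrable (integrable1_mulr_bounded i1 mh hc) => // x _.
by rewrite /= mulr1.
Qed.

(** On [S = {g < f}] the function [f - g] is positive, while its integral is at most 0 by
    hypothesis; so it vanishes a.e. on [S]. *)
Lemma Rintegral_le_ae {d} {T : measurableType d} {R : realType}
    (mu : {measure set T -> \bar R}) (f g : T -> R) :
  mu.-integrable setT (EFin \o f) -> mu.-integrable setT (EFin \o g) ->
  (forall E, measurable E -> \int[mu]_(x in E) f x <= \int[mu]_(x in E) g x) ->
  \forall x \ae mu, f x <= g x.
Proof.
move=> fi gi fg.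
have mf : measurable_fun setT f by exact/measurable_EFinP/(measurable_int mu).
have mg : measurable_fun setT g by exact/measurable_EFinP/(measurable_int mu).
pose S := [set x | g x < f x].
have mS : measurable S by rewrite -[S]setTI; exact: measurable_fun_ltr.
have fgi : mu.-integrable setT (EFin \o (f \- g)).
  by rewrite /comp/=; under eq_fun do rewrite EFinB; exact: integrableB.
have fgiS : mu.-integrable S (EFin \o (f \- g)) by exact: integrableS fgi.
suff : ae_eq mu S (EFin \o (f \- g)) (cst 0%E).
  apply: filterS => x /= H; rewrite leNgt; apply/negP => gfx.
  by have [/eqP] := H gfx; rewrite subr_eq0 => /eqP fgx; rewrite fgx ltxx in gfx.
apply/ae_eq_integral_abs => //; first exact: measurable_int fgiS.
under eq_integral => x xS.
  rewrite gee0_abs; last by rewrite lee_fin subr_ge0 ltW//; exact: set_mem.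
  over.
rewrite -[LHS]fineK; last exact: integrable_fin_num.
congr EFin; apply/eqP; rewrite eq_le; apply/andP; split.
  rewrite [leLHS](@RintegralB _ _ _ mu S f g)//; last 2 first.
  - exact: integrableS fi.
  - exact: integrableS gi.
  by rewrite subr_le0 fg.
by apply: Rintegral_ge0 => x Sx; rewrite subr_ge0 ltW.
Qed.

Lemma charge_exists {d} {T : measurableType d} {R : realType}
    (nu : set T -> \bar R) :
  nu set0 = 0%E -> (forall E, measurable E -> nu E \is a fin_num) ->
  semi_sigma_additive nu ->
  exists c : {charge set T -> \bar R}, forall E, c E = nu E.
Proof.
move=> nu0 nufin nusig.
pose H := isCharge.Build _ _ _ nu nu0 nufin nusig.
pose c : {charge set T -> \bar R} := HB.pack nu H.
by exists c.
Qed.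

(** * Riesz representation of functionals dominated by a weighted $L^1$ seminorm *)

Section riesz.
Import HBNNSimple.
Context {d} {T : measurableType d} {R : realType}.
Variable mu : {finite_measure set T -> \bar R}.

Variable phi : T -> R.
Hypothesis phi0 : forall x, 0 <= phi x.
Hypothesis iphi : mu.-integrable setT (EFin \o phi).

(** The space $L^1(\phi\mu)$. Measurability of [h] is a separate condition, since the product with
    [phi] does not see [h] where [phi] vanishes. *)
Definition weighted_L1 := [set h : T -> R | measurable_fun setT h /\
  mu.-integrable setT (EFin \o (h \* phi))].

Let mphi : measurable_fun setT phi.
Proof. exact/measurable_EFinP/(measurable_int mu). Qed.

Lemma weighted_L1_bounded (h : T -> R) c : measurable_fun setT h ->
  (forall x, `|h x| <= c) -> weighted_L1 h.
Proof.
move=> mh hc; split => //.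
have := integrableZl measurableT c iphi; apply: le_integrable => //.
  by apply/measurable_EFinP; exact: measurable_funM.
move=> x _ /=; rewrite lee_fin !normrM ler_wpM2r//.
by rewrite (le_trans (hc x))// ler_norm.
Qed.

Lemma weighted_L1_indic E : measurable E -> weighted_L1 \1_E.
Proof.
move=> mE; apply: (@weighted_L1_bounded _ 1); first exact: measurable_indic.
by move=> x; rewrite indicE; case: (_ \in _); rewrite ?normr1 ?normr0.
Qed.

Lemma weighted_L1D a (h k : T -> R) : weighted_L1 h -> weighted_L1 k ->
  weighted_L1 (a *: h + k).
Proof.
move=> [mh ih] [mk ik]; split.
  by apply: measurable_funD => //; exact: measurable_funM.
have := integrableD measurableT (integrableZl measurableT a ih) ik.
apply: eq_integrable => // x _ /=.
change (a%:E * (h x * phi x)%:E + (k x * phi x)%:E = ((a * h x + k x) * phi x)%:E)%E.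
by rewrite mulrDl -mulrA.
Qed.

Lemma weighted_L1_sum n (a : 'I_n -> R) (E : 'I_n -> set T) :
  (forall i, measurable (E i)) ->
  weighted_L1 (fun x => \sum_(i < n) a i * \1_(E i) x).
Proof.
elim: n a E => [|n IH] a E mE.
  under eq_fun do rewrite big_ord0.
  by apply: (@weighted_L1_bounded _ 0) => // x; rewrite normr0.
rewrite (_ : (fun _ => _) = a ord_max *: (\1_(E ord_max) : T -> R) +
   (fun x => \sum_(i < n) a (widen_ord (leqnSn n) i) *
                           \1_(E (widen_ord (leqnSn n) i)) x)); last first.
  by apply/funext => x; rewrite big_ord_recr/= addrC.
by apply: weighted_L1D; [exact: weighted_L1_indic|exact: IH].
Qed.

Variable l : (T -> R) -> R.
Hypothesis lin : forall a h k, weighted_L1 h -> weighted_L1 k ->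
  l (a *: h + k) = a * l h + l k.
Hypothesis l_le : forall h, weighted_L1 h -> `|l h| <= \int[mu]_x (`|h x| * phi x).

Let l0 : l 0 = 0.
Proof.
have W0 : weighted_L1 0.
  apply: (@weighted_L1_bounded (cst 0) 0); first exact: measurable_cst.
  by move=> x; rewrite normr0.
by have := lin 1 W0 W0; rewrite scale1r addr0 mul1r => /eqP; rewrite -subr_eq subrr => /eqP.
Qed.

Let l_indic_le E : measurable E -> `|l \1_E| <= \int[mu]_(x in E) phi x.
Proof.
move=> mE; apply: le_trans (l_le (weighted_L1_indic mE)) _.
rewrite [leRHS]Rintegral_mkcond le_eqVlt; apply/orP; left; apply/eqP.
apply: eq_Rintegral => x _; rewrite patchE indicE.
by case: (x \in E); rewrite ?normr1 ?mul1r// normr0 mul0r.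
Qed.

Let l_indicU E F : measurable E -> measurable F -> [disjoint E & F] ->
  l \1_(E `|` F) = l \1_E + l \1_F.
Proof.
move=> mE mF EF; rewrite -[l \1_E]mul1r -lin; [|exact: weighted_L1_indic..].
congr l; apply/funext => x; rewrite scale1r /= !indicE in_setU.
have := EF; rewrite disj_set2E => /eqP /seteqP[+ _] => /(_ x).
rewrite fctE /= !indicE.
have [xE|] := boolP (x \in E); have [xF|] := boolP (x \in F) => //=; rewrite ?addr0 ?add0r//.
by case; split; exact/set_mem.
Qed.

(** Stated for a general [N] because it is applied both to [E => l \1_E] and to the integral of
    [phi] over [E], whose tails are then compared. *)
Let additive_tail (N : set T -> R) (F : (set T)^nat) :
  N set0 = 0 ->
  (forall A B, measurable A -> measurable B -> [disjoint A & B] ->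
    N (A `|` B) = N A + N B) ->
  (forall i, measurable (F i)) -> trivIset setT F ->
  forall n, N (\bigcup_i F i) = \sum_(0 <= i < n) N (F i) +
    N (\bigcup_i F i `\` \big[setU/set0]_(i < n) F i).
Proof.
move=> N0 NU mF tF n.
have mU k : measurable (\big[setU/set0]_(i < k) F i) by exact: bigsetU_measurable.
have NS k : N (\big[setU/set0]_(i < k) F i) = \sum_(0 <= i < k) N (F i).
  elim: k => [|k IH]; first by rewrite big_ord0 big_nil.
  rewrite big_ord_recr big_nat_recr//= NU ?IH//; first exact: mU.
  rewrite disj_set2E; apply/eqP/seteqP; split=> // x [].
  rewrite -bigcup_mkord => -[i /= ik Fi] Fk.
  by have ik' := tF i k I I (ex_intro _ x (conj Fi Fk)); rewrite ik' ltnn in ik.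
rewrite -NS -NU//; last 2 first.
- by apply: measurableD => //; exact: bigcupT_measurable.
- by rewrite disj_set2E setIDA setIC -setIDA setDv setI0.
congr N; rewrite setDUK//.
by move=> x; rewrite -bigcup_mkord => -[i _ Fix]; exists i.
Qed.

(** Countable additivity: the error after [n] terms is [l] of the indicator of the tail, dominated
    by the integral of [phi] over the tail, which tends to 0. *)
Let l_charge : exists c : {charge set T -> \bar R},
  forall E, c E = (l \1_E)%:E.
Proof.
apply: (@charge_exists _ _ _ (fun E => (l \1_E)%:E)) => //.
  by rewrite indic0 l0.
move=> F mF tF mUF.
pose K E := \int[mu]_(x in E) phi x.
have K0 : K set0 = 0 by rewrite /K Rintegral_set0.
have KU A B : measurable A -> measurable B -> [disjoint A & B] ->
    K (A `|` B) = K A + K B.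
  move=> mA mB AB; rewrite /K Rintegral_setU//.
  by apply: (integrableS measurableT) => //; exact: measurableU.
have KF : (fun n => \sum_(0 <= i < n) K (F i)) @ \oo --> K (\bigcup_i F i).
  have KE E : measurable E -> (\int[mu]_(x in E) (phi x)%:E = (K E)%:E)%E.
    move=> mE; rewrite /K /Rintegral fineK//.
    by apply: integrable_fin_num => //; exact: integrableS iphi.
  have : (fun n => \sum_(0 <= i < n) \int[mu]_(x in F i) (phi x)%:E)%E @ \oo -->
      (\int[mu]_(x in \bigcup_i F i) (phi x)%:E)%E.
    exact: (@charge_semi_sigma_additive _ _ _ (induced_charge iphi) F mF tF mUF).
  rewrite (KE _ mUF); under eq_fun do under eq_bigr do rewrite KE//.
  by under eq_fun do rewrite sumEFin; move/fine_cvgP => [].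
under eq_fun do rewrite sumEFin.
apply: cvg_EFin; first exact: nearW.
rewrite /comp/=; move/cvgrPdist_le : KF => KF.
apply/cvgrPdist_le => e e0; near=> n.
have -> : l \1_(\bigcup_i F i) - \sum_(0 <= i < n) l \1_(F i) =
    l \1_(\bigcup_i F i `\` \big[setU/set0]_(i < n) F i).
  rewrite (@additive_tail (fun E => l \1_E) _ _ _ mF tF n)//.
  - by rewrite addrAC subrr add0r.
  - by rewrite indic0.
apply: le_trans (l_indic_le _) _.
  by apply: measurableD => //; exact: bigsetU_measurable.
rewrite -/(K _).
have -> : K (\bigcup_i F i `\` \big[setU/set0]_(i < n) F i) =
    K (\bigcup_i F i) - \sum_(0 <= i < n) K (F i).
  by rewrite (additive_tail K0 KU mF tF n) addrAC subrr add0r.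
apply: le_trans (ler_norm _) _.
by near: n; exact: KF.
Unshelve. all: by end_near. Qed.

(** A Radon-Nikodym density. The estimate of [l \1_E] by the integral of [phi] over [E] yields
    absolute continuity and, applied to both signs, the bound by [phi] almost everywhere. *)
Let density : exists g : T -> R,
  [/\ mu.-integrable setT (EFin \o g), forall x, `|g x| <= phi x &
      forall E, measurable E -> l \1_E = \int[mu]_(x in E) g x].
Proof.
have [c cE] := l_charge.
have cmu : c `<< mu.
  apply/null_content_dominatesP => A mA muA0.
  rewrite cE; congr EFin; apply/eqP; rewrite -normr_le0.
  apply: le_trans (l_indic_le mA) _.
  rewrite /Rintegral null_set_integral//.
  by apply/measurable_EFinP; exact: measurable_funS mphi.
pose g0 x := fine (Radon_Nikodym c mu x).
have ig0 : mu.-integrable setT (EFin \o g0).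
  apply: eq_integrable (Radon_Nikodym_integrable cmu) => // x _.
  by rewrite /= fineK// Radon_Nikodym_fin_num.
have mg0 : measurable_fun setT g0 by exact/measurable_EFinP/(measurable_int mu).
have g0E E : measurable E -> l \1_E = \int[mu]_(x in E) g0 x.
  move=> mE; rewrite /Rintegral; apply: EFin_inj.
  rewrite -cE (Radon_Nikodym_integral cmu mE) fineK.
    by apply: eq_integral => x _; rewrite fineK// Radon_Nikodym_fin_num.
  by apply: integrable_fin_num => //; exact: integrableS ig0.
have g0phi : \forall x \ae mu, g0 x <= phi x.
  apply: Rintegral_le_ae => // E mE; rewrite -g0E//.
  exact: le_trans (ler_norm _) (l_indic_le mE).
have iN : mu.-integrable setT (EFin \o (fun x => - g0 x)) by exact: integrableN ig0.
have g0phiN : \forall x \ae mu, - g0 x <= phi x.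
  apply: Rintegral_le_ae => // E mE.
  under eq_Rintegral do rewrite -mulN1r.
  rewrite RintegralZl//; last exact: integrableS ig0.
  rewrite mulN1r -g0E//.
  by apply: le_trans (l_indic_le mE); rewrite -normrN ler_norm.
(* Truncation between [- phi] and [phi] changes [g0] only on a null set and makes the bound hold at
   every point. *)
pose g x := Num.max (Num.min (g0 x) (phi x)) (- phi x).
have mg : measurable_fun setT g.
  by apply: measurable_maxr; [exact: measurable_minr|exact: measurable_funN].
have gphi x : `|g x| <= phi x.
  rewrite ler_norml /g le_max lexx orbT/= ge_max ge_min lexx orbT/=.
  by rewrite (le_trans _ (phi0 x))// lerNl oppr0.
have g0g : \forall x \ae mu, g0 x = g x.
  apply: filterS2 g0phi g0phiN => x h1 h2.
  by rewrite /g (min_idPl h1) (max_idPl _)// lerNl.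
exists g; split => //.
  apply: le_integrable iphi => //; first exact/measurable_EFinP.
  by move=> x _ /=; rewrite lee_fin (le_trans (gphi x))// ler_norm.
move=> E mE; rewrite g0E//; congr fine.
apply: ae_eq_integral => //.
- by apply/measurable_EFinP; exact: measurable_funS mg0.
- by apply/measurable_EFinP; exact: measurable_funS mg.
- by apply: filterS g0g => x -> .
Qed.

(** The formula passes from indicators to simple functions by linearity, to nonnegative functions by
    approximation from below, and to all [h] through positive and negative parts. *)
Theorem riesz_weighted : exists g : T -> R,
  [/\ mu.-integrable setT (EFin \o g), forall x, `|g x| <= phi x &
      forall h, weighted_L1 h -> l h = \int[mu]_x (h x * g x)].
Proof.
have [g [ig gphi gE]] := density.
have mg : measurable_fun setT g by exact/measurable_EFinP/(measurable_int mu).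
exists g; split => //.
have hg_le (h k : T -> R) x : `|h x| <= `|k x| -> `|h x * g x| <= `|k x * phi x|.
  by move=> hk; rewrite !normrM ler_pM// (le_trans (gphi x))// ler_norm.
have ihg h : weighted_L1 h -> mu.-integrable setT (EFin \o (h \* g)).
  move=> [mh ih]; apply: le_integrable ih => //.
    by apply/measurable_EFinP; exact: measurable_funM.
  by move=> x _ /=; rewrite lee_fin; exact: hg_le.
have linG a h k : weighted_L1 h -> weighted_L1 k ->
    l h = \int[mu]_x (h x * g x) -> l k = \int[mu]_x (k x * g x) ->
    l (a *: h + k) = \int[mu]_x ((a *: h + k) x * g x).
  move=> Wh Wk lh lk; rewrite lin// lh lk -RintegralZl//; last exact: ihg.
  rewrite -RintegralD//; last 2 first.
  - by have := integrableZl measurableT a (ihg _ Wh).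
  - exact: ihg.
  apply: eq_Rintegral => x _.
  change (a * (h x * g x) + k x * g x = (a * h x + k x) * g x).
  by rewrite mulrDl mulrA.
have simple n (a : 'I_n -> R) (E : 'I_n -> set T) : (forall i, measurable (E i)) ->
    l (fun x => \sum_(i < n) a i * \1_(E i) x) =
    \int[mu]_x ((\sum_(i < n) a i * \1_(E i) x) * g x).
  elim: n a E => [|n IH] a E mE.
    under eq_fun do rewrite big_ord0.
    under eq_Rintegral do rewrite big_ord0 mul0r.
    by rewrite Rintegral_cst// mul0r l0.
  have sE : (fun x => \sum_(i < n.+1) a i * \1_(E i) x) =
     a ord_max *: (\1_(E ord_max) : T -> R) +
     (fun x => \sum_(i < n) a (widen_ord (leqnSn n) i) *
                           \1_(E (widen_ord (leqnSn n) i)) x).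
    by apply/funext => x; rewrite big_ord_recr/= addrC.
  rewrite (@eq_Rintegral _ _ _ mu setT (fun x => (a ord_max *: (\1_(E ord_max) : T -> R) +
     (fun x => \sum_(i < n) a (widen_ord (leqnSn n) i) *
                           \1_(E (widen_ord (leqnSn n) i)) x)) x * g x)); last first.
    by move=> x _; rewrite -sE.
  rewrite sE; apply: (linG _ _ _ _ _ _).
  - exact: weighted_L1_indic.
  - exact: weighted_L1_sum.
  - rewrite gE// Rintegral_mkcond; apply: eq_Rintegral => x _.
    by rewrite patchE indicE; case: (x \in _); rewrite ?mul1r ?mul0r.
  - exact: IH.
have nonneg h : weighted_L1 h -> (forall x, 0 <= h x) -> l h = \int[mu]_x (h x * g x).
  move=> [mh ih] h0.
  have mhE : measurable_fun setT (EFin \o h) by exact/measurable_EFinP.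
  have hE0 x : setT x -> (0 <= (EFin \o h) x)%E by rewrite lee_fin.
  pose s n : T -> R := nnsfun_approx measurableT mhE n.
  have s0 n x : 0 <= s n x by rewrite /s.
  have sh n x : s n x <= h x.
    by rewrite -lee_fin /s nnsfun_approxE; exact: le_approx.
  have shn n x : `|s n x| <= `|h x| by rewrite !ger0_norm.
  have scvg x : s n x @[n --> \oo] --> h x.
    by have := cvg_nnsfun_approx measurableT mhE hE0 (I : setT x) => /fine_cvgP[].
  have ms n : measurable_fun setT (s n) by rewrite /s.
  have Ws n : weighted_L1 (s n).
    split => //; apply: le_integrable ih => //.
      by apply/measurable_EFinP; exact: measurable_funM.
    by move=> x _ /=; rewrite lee_fin !normrM ler_wpM2r.
  have lsn n : l (s n) = \int[mu]_x (s n x * g x).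
    pose S := fset_set (range (s n)).
    have sE x : s n x = \sum_(i < #|`S|) S`_i * \1_(s n @^-1` [set S`_i]) x.
      by rewrite /s fimfunEord.
    under [RHS]eq_Rintegral => x _ do rewrite sE.
    rewrite -simple; last by move=> i; rewrite -[X in measurable X]setTI; exact: ms.
    by congr l; apply/funext => x; rewrite sE.
  have c1 x : (s n x * phi x)%:E @[n --> \oo] --> (h x * phi x)%:E.
    by apply: cvg_EFin; [exact: nearW|exact: cvgMl].
  have c2 x : (s n x * g x)%:E @[n --> \oo] --> (h x * g x)%:E.
    by apply: cvg_EFin; [exact: nearW|exact: cvgMl].
  have b1 x n : (`|(s n x * phi x)%:E| <= (h x * phi x)%:E)%E.
    by rewrite lee_fin ger0_norm ?mulr_ge0// ler_wpM2r.
  have b2 x n : (`|(s n x * g x)%:E| <= (h x * phi x)%:E)%E.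
    rewrite lee_fin (le_trans (hg_le _ _ _ (shn n x)))//.
    by rewrite ger0_norm ?mulr_ge0.
  (* Both sides of the formula are continuous along [s n]: [l] because the weighted $L^1$ distance
     to [h] tends to 0, the integral because [|g| <= phi] makes [h * phi] a majorant. *)
  have [_ d1 _] := dominated_convergence measurableT
    (fun n => measurable_int mu (Ws n).2) (measurable_int mu ih)
    (aeW _ (fun x _ => c1 x)) ih (aeW _ (fun x n _ => b1 x n)).
  have [_ _ d2] := dominated_convergence measurableT
    (fun n => measurable_int mu (ihg _ (Ws n)))
    (measurable_int mu (ihg _ (conj mh ih)))
    (aeW _ (fun x _ => c2 x)) ih (aeW _ (fun x n _ => b2 x n)).
  have {}d2 : l (s n) @[n --> \oo] --> \int[mu]_x (h x * g x).
    move: d2; rewrite /comp/=.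
    rewrite -[X in _ --> X]fineK; last first.
      by apply: integrable_fin_num => //; exact: (ihg _ (conj mh ih)).
    move=> /fine_cvgP[_]; apply: cvg_trans; apply: near_eq_cvg.
    by apply: nearW => n; rewrite lsn.
  have {}d1 : l (s n) @[n --> \oo] --> l h.
    have {}d1 : \int[mu]_x (`|s n x - h x| * phi x) @[n --> \oo] --> 0.
      move/fine_cvgP : d1 => [_]; apply: cvg_trans; apply: near_eq_cvg.
      apply: nearW => n /=; congr fine; apply: eq_integral => x _ /=.
      by rewrite -mulrBl normrM (ger0_norm (phi0 x)).
    apply/cvgrPdist_le => e e0; near=> n.
    have -> : l h - l (s n) = - l ((-1) *: h + s n).
      by rewrite lin// mulN1r opprD opprK.
    rewrite normrN; apply: le_trans (l_le _) _.
      exact: weighted_L1D.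
    apply: le_trans (ler_norm _) _; rewrite -normrN -sub0r.
    near: n; move/cvgrPdist_le : d1 => /(_ _ e0).
    apply: filterS => n.
    apply: le_trans; rewrite le_eqVlt; apply/orP; left; apply/eqP.
    congr (`|_ - _|); apply: eq_Rintegral => x _; congr (_ * _).
    change (`|-1 * h x + s n x| = `|s n x - h x|).
    by rewrite mulN1r addrC.
  exact: (cvg_unique (@norm_hausdorff _ _) d1 d2).
move=> h [mh ih].
pose hp x := Num.max (h x) 0; pose hn x := Num.max (- h x) 0.
have mhp : measurable_fun setT hp by exact: measurable_maxr.
have mhn : measurable_fun setT hn.
  by apply: measurable_maxr => //; exact: measurable_funN.
have Whp : weighted_L1 hp.
  split=> //; apply: le_integrable ih => //.
    by apply/measurable_EFinP; exact: measurable_funM.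
  move=> x _ /=; rewrite lee_fin !normrM ler_wpM2r// /hp.
  by case: (leP (h x) 0) => // _; rewrite normr0.
have Whn : weighted_L1 hn.
  split=> //; apply: le_integrable ih => //.
    by apply/measurable_EFinP; exact: measurable_funM.
  move=> x _ /=; rewrite lee_fin !normrM ler_wpM2r// /hn.
  by case: (leP (- h x) 0) => // _; rewrite ?normr0 ?normrN.
have hE : h = -1 *: hn + hp.
  apply/funext => x; change (h x = -1 * hn x + hp x).
  rewrite mulN1r /hn /hp; case: (leP (h x) 0); case: (leP (- h x) 0); lra.
rewrite hE linG//.
- by apply: nonneg => // x; rewrite le_max lexx orbT.
- by apply: nonneg => // x; rewrite le_max lexx orbT.
Unshelve. all: by end_near. Qed.
End riesz.

(** * The asymptotic slope *)

Section slope.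
Context {R : realType} {X : pmetricType R}.
Implicit Types (f g : X -> R) (x : X) (c d e r : R).

(** The bound of [lip_a f x] by the real [c], unfolded into an epsilon-delta form so that sums,
    multiples and products are estimated in the reals. *)
Definition slope_le f x c := 0 <= c /\ forall e, 0 < e -> exists2 r, 0 < r &
  forall y z, ball x r y -> ball x r z -> `|f y - f z| <= (c + e) * mdist y z.

Lemma slope_le_lip_a f x c : slope_le f x c -> (lip_a f x <= c%:E)%E.
Proof.
move=> [c0 H]; apply/lee_addgt0Pr => e e0; have [r r0 fr] := H _ e0.
apply: (@le_trans _ _ (Lip f (ball x r))); first by apply: ereal_inf_lbound; exists r.
apply: ge_ereal_sup => _ [->|[[y z] /= [xy [xz yz]] <-]].
  by rewrite -EFinD lee_fin addr_ge0// ltW.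
by rewrite -EFinD lee_fin ler_pdivrMr ?fr// mdist_gt0; exact/eqP.
Qed.

Lemma lip_a_ge0 f x : (0 <= lip_a f x)%E.
Proof.
by apply: le_ereal_inf_tmp => _ [r r0 <-]; apply: ereal_sup_ubound; left.
Qed.

Lemma lip_a_slope_le f x : (lip_a f x < +oo)%E -> slope_le f x (fine (lip_a f x)).
Proof.
move=> fin; split; first by rewrite fine_ge0// lip_a_ge0.
move=> e e0.
have : (lip_a f x < (fine (lip_a f x) + e)%:E)%E.
  by rewrite EFinD fineK ?ge0_fin_numE ?lip_a_ge0// lteDl// ?lte_fin// ge0_fin_numE ?lip_a_ge0.
move=> /ereal_inf_lt[_ [r r0 <-] /ltW fr]; exists r => // y z xy xz.
have [->|yz] := eqVneq y z; first by rewrite subrr normr0 mdistxx mulr0.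
rewrite -ler_pdivrMr ?mdist_gt0// -lee_fin; apply: le_trans fr.
by apply: ereal_sup_ubound; right; exists (y, z) => //; split => //; split => //; exact/eqP.
Qed.

Lemma slope_le0 x : slope_le 0 x 0.
Proof.
split=> // e e0; exists 1 => // y z _ _.
by rewrite subrr normr0 add0r mulr_ge0 ?mdist_ge0// ltW.
Qed.

Lemma slope_leD f g x c d : slope_le f x c -> slope_le g x d ->
  slope_le (f + g) x (c + d).
Proof.
move=> [c0 Hf] [d0 Hg]; split; first exact: addr_ge0.
move=> e e0; have e2 : 0 < e / 2 by rewrite divr_gt0.
have [r r0 fr] := Hf _ e2; have [s s0 gs] := Hg _ e2.
exists (Num.min r s); first by rewrite lt_min r0.
move=> y z xy xz.
have lr : Num.min r s <= r by rewrite ge_min lexx.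
have ls : Num.min r s <= s by rewrite ge_min lexx orbT.
have := fr _ _ (le_ball lr xy) (le_ball lr xz).
have := gs _ _ (le_ball ls xy) (le_ball ls xz).
change (`|(f + g) y - (f + g) z|) with (`|(f y + g y) - (f z + g z)|).
rewrite opprD addrACA => h1 h2; apply: le_trans (ler_normD _ _) _.
apply: le_trans (lerD h2 h1) _; rewrite -mulrDl le_eqVlt; apply/orP; left.
by apply/eqP; congr (_ * _); lra.
Qed.

Lemma slope_leZ a f x c : slope_le f x c -> slope_le (a *: f) x (`|a| * c).
Proof.
move=> [c0 Hf]; split; first exact: mulr_ge0.
(* Dividing [e] by [|a| + 1] rather than [|a|] covers [a = 0]. *)
move=> e e0; have a1 : 0 < `|a| + 1 by rewrite ltr_wpDl.
have [r r0 fr] := Hf _ (divr_gt0 e0 a1); exists r => // y z xy xz.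
change (`|(a *: f) y - (a *: f) z|) with (`|a * f y - a * f z|).
rewrite -mulrBr normrM; apply: le_trans (ler_wpM2l _ (fr _ _ xy xz)) _ => //.
rewrite mulrA ler_wpM2r ?mdist_ge0// mulrDr lerD2l.
by rewrite mulrCA ger_pMr// ler_pdivrMr// mul1r lerDl.
Qed.

(* The function differs by a constant from the product of [f - f x] and
   [g - g x], both of which vanish at [x]. *)
Lemma slope_le_leibniz f g x c d : slope_le f x c -> slope_le g x d ->
  slope_le (f * g - f x *: g - g x *: f) x 0.
Proof.
move=> [c0 Hf] [d0 Hg]; split=> // e e0.
have [r r0 fr] := Hf _ ltr01; have [s s0 gs] := Hg _ ltr01.
(* On a ball of radius [t] about [x], each factor is Lipschitz with constant [c + 1] or [d + 1] and
   at most that constant times [t] in size, so the product is Lipschitz with constant [k * t]. *)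
pose k := 2 * (c + 1) * (d + 1).
have k0 : 0 < k by rewrite /k; do 2 (apply: mulr_gt0 => //; last by rewrite ltr_wpDl).
pose t := Num.min (Num.min r s) (e / k).
have t0 : 0 < t by rewrite !lt_min r0 s0 divr_gt0.
exists t => // y z xy xz.
have tr : t <= r by rewrite /t !ge_min lexx.
have ts : t <= s by rewrite /t !ge_min lexx orbT.
have tk : k * t <= e by rewrite mulrC -ler_pdivlMr// /t ge_min lexx orbT.
have xx : ball x t x by exact: ballxx.
have dt w : ball x t w -> mdist w x <= t.
  by rewrite ballEmdist/= metric_sym => /ltW.
have fyz := fr _ _ (le_ball tr xy) (le_ball tr xz).
have gyz := gs _ _ (le_ball ts xy) (le_ball ts xz).
have fzx := fr _ _ (le_ball tr xz) (le_ball tr xx).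
have gyx := gs _ _ (le_ball ts xy) (le_ball ts xx).
change ((f * g - f x *: g - g x *: f) y - (f * g - f x *: g - g x *: f) z)
  with ((f y * g y - f x * g y - g x * f y) - (f z * g z - f x * g z - g x * f z)).
have -> : (f y * g y - f x * g y - g x * f y) - (f z * g z - f x * g z - g x * f z) =
   (f y - f z) * (g y - g x) + (f z - f x) * (g y - g z) by ring.
apply: le_trans (ler_normD _ _) _; rewrite !normrM.
have D0 := mdist_ge0 y z; set D := mdist y z in D0 fyz gyz *.
have gyx' : `|g y - g x| <= (d + 1) * t.
  by apply: le_trans gyx _; rewrite ler_wpM2l ?dt// addr_ge0.
have fzx' : `|f z - f x| <= (c + 1) * t.
  by apply: le_trans fzx _; rewrite ler_wpM2l ?dt// addr_ge0.
have h1 := ler_pM (normr_ge0 _) (normr_ge0 _) fyz gyx'.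
have h2 := ler_pM (normr_ge0 _) (normr_ge0 _) fzx' gyz.
apply: le_trans (lerD h1 h2) _; rewrite add0r.
have -> : (c + 1) * D * ((d + 1) * t) + (c + 1) * t * ((d + 1) * D) = k * t * D.
  by rewrite /k; ring.
exact: ler_wpM2r.
Qed.

Lemma continuous_borel_measurable f : continuous f ->
  measurable_fun [set: borel X] (f : borel X -> R).
Proof.
move=> cf; apply: (measurability _ (RGenOInfty.measurableE R)) => //.
move=> _ [_ [a ->] <-]; rewrite setTI; apply: sub_sigma_algebra.
by apply: (open_comp (f := f)) => //; exact: interval_open.
Qed.

End slope.

(** * Bounded functions, and a.e. equality tested on measurable sets *)

Section Lfun_bounded.
Context {d} {T : measurableType d} {R : realType}.
Variable mu : {measure set T -> \bar R}.

Lemma ess_bounded_Lfun (f : T -> R) c : measurable_fun setT f ->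
  (forall x, `|f x| <= c) -> f \in Lfun mu +oo.
Proof.
move=> mf fc; rewrite inE; apply/andP; split; rewrite inE//=.
rewrite /finite_norm unlock /=; case: ifPn => // _.
apply: (@le_lt_trans _ _ c%:E); last by rewrite ltry.
by apply/ess_supP; apply: nearW => x; rewrite lee_fin.
Qed.

Lemma Lfunoo_norm_le (f : T -> R) c : 0 <= c -> (\forall x \ae mu, `|f x| <= c) ->
  ('N[mu]_+oo[EFin \o f] <= c%:E)%E.
Proof.
move=> c0 fc; rewrite unlock; case: ifPn => // _; apply/ess_supP.
by apply: filterS fc => x; rewrite lee_fin.
Qed.

Lemma Lfun_measurable p (f : T -> R) : f \in Lfun mu p -> measurable_fun setT f.
Proof. by move=> /andP[]; rewrite inE. Qed.

(** Linearity and the Leibniz rule for the derivation are obtained this way, its values being known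
    through their integrals. *)
Lemma ae_eq_Rintegral_indic (p q : T -> R) :
  mu.-integrable setT (EFin \o p) -> mu.-integrable setT (EFin \o q) ->
  (forall E, measurable E -> \int[mu]_x (\1_E x * p x) = \int[mu]_x (\1_E x * q x)) ->
  p = q %[ae mu].
Proof.
move=> ip iq pq.
have mk (h : T -> R) E : \int[mu]_(x in E) h x = \int[mu]_x (\1_E x * h x).
  rewrite Rintegral_mkcond; apply: eq_Rintegral => x _.
  by rewrite patchE indicE; case: (x \in _); rewrite ?mul1r ?mul0r.
have pleq : \forall x \ae mu, p x <= q x.
  by apply: Rintegral_le_ae => // E mE; rewrite (mk p) (mk q) pq.
have qlep : \forall x \ae mu, q x <= p x.
  by apply: Rintegral_le_ae => // E mE; rewrite (mk p) (mk q) pq.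
by apply: filterS2 pleq qlep => x h1 h2 _; apply/eqP; rewrite eq_le h1.
Qed.

End Lfun_bounded.

(** * Derivations from linear functionals *)

Section duality.
Context {R : realType} {X : pmetricType R}.
Variable m : {finite_measure set (borel X) -> \bar R}.
Variable A : set (X -> R).
Hypothesis AL : A `<=` LIP_star m.
Hypothesis A0 : A 0.
Hypothesis ALin : forall a u v, A u -> A v -> A (a *: u + v).
Hypothesis AM : forall u v, A u -> A v -> A (u * v).
Implicit Types (u v f : X -> R) (phi : borel X -> R).

Local Notation integrable1 h := (m.-integrable [set: borel X] (EFin \o (h : borel X -> R))).
(** For [u] in [A] the asymptotic slope is finite everywhere, so the default value of [fine] does
    not occur. *)
Definition slope u (x : X) : R := fine (lip_a u x).

Lemma EFin_slope u x : A u -> (slope u x)%:E = lip_a u x.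
Proof.
move=> /AL[[_ fin] _ _]; rewrite /slope fineK//.
by rewrite ge0_fin_numE ?lip_a_ge0.
Qed.

Lemma slope_ge0 u x : 0 <= slope u x.
Proof. by rewrite fine_ge0// lip_a_ge0. Qed.

Lemma slope_slope_le u x : A u -> slope_le u x (slope u x).
Proof. by move=> /AL[[_ fin] _ _]; exact: lip_a_slope_le. Qed.

Lemma integrable_slope u : A u -> integrable1 (slope u).
Proof.
move=> Au; have [_ _] := AL Au; apply: eq_integrable => // x _.
by rewrite /= EFin_slope.
Qed.

Lemma measurable_A u : A u -> measurable_fun [set: borel X] (u : borel X -> R).
Proof. by move=> /AL[[cu _] _ _]; exact: continuous_borel_measurable. Qed.

Lemma bounded_A u : A u -> exists M, forall x, `|u x| <= M.
Proof.
move=> /AL[_ [M [_ Mu]] _]; exists (M + 1) => x.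
by apply: Mu => //; rewrite ltrDl.
Qed.

Lemma integrable_A u : A u -> integrable1 u.
Proof.
move=> Au; have [M uM] := bounded_A Au.
exact: (integrable1_bounded m (measurable_A Au) uM).
Qed.

Variable lam : R.
Hypothesis lam0 : 0 < lam.

(* [w.1] is a field of differentials, $x \mapsto d(w.1\,x)_x$, and [w.2] an
   element of $L^1$. Only an integrable majorant of the pointwise norms is
   asked for, so the measurability of $x \mapsto lip_a(w.1\,x + u)(x)$ is
   never needed. *)
Definition cost (w : (X -> X -> R) * (X -> R)) (c : R) :=
  exists u phi, [/\ A u, integrable1 phi,
    forall x, slope_le (w.1 x + u) x (phi x), integrable1 w.2 &
    \int[m]_x phi x + lam * \int[m]_x `|w.2 x - u x| <= c].

Lemma cost_ge0 w c : cost w c -> 0 <= c.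
Proof.
move=> [u [phi [Au iphi sphi iv]]]; apply: le_trans; apply: addr_ge0.
  by apply: Rintegral_ge0 => x _; case: (sphi x).
by apply: mulr_ge0; [exact: ltW|exact: Rintegral_ge0].
Qed.

Lemma cost_form (om : X -> X -> R) phi : integrable1 phi ->
  (forall x, slope_le (om x) x (phi x)) -> cost (om, 0) (\int[m]_x phi x).
Proof.
move=> iphi sphi; exists 0, phi; split => //=.
- by move=> x; rewrite addr0; exact: sphi.
- exact: integrable_A.
under [X in _ + _ * X <= _]eq_Rintegral => x _ do rewrite subrr normr0.
by rewrite Rintegral_cst// mul0r mulr0 addr0.
Qed.

Lemma cost_L1 v : integrable1 v -> cost (0, v) (lam * \int[m]_x `|v x|).
Proof.
move=> iv; exists 0, (cst 0); split => //=.
- exact: (integrable_A A0).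
- by move=> x; rewrite addr0; exact: slope_le0.
rewrite Rintegral_cst// mul0r add0r le_eqVlt; apply/orP; left; apply/eqP.
by congr (_ * _); apply: eq_Rintegral => x _; rewrite subr0.
Qed.

(** The competitor [- u] cancels the differential and the $L^1$ part at once. This is the source of
    the divergence identity. *)
Lemma cost_diag u : A u -> cost (fun=> u, - u) 0.
Proof.
move=> Au; exists (- u), (cst 0); split => //=.
- by have := ALin (-1) Au A0; rewrite addr0 scaleN1r.
- exact: (integrable_A A0).
- by move=> x; rewrite subrr; exact: slope_le0.
- by apply: eq_integrable (integrable1Z (-1) (integrable_A Au)) => // x _; rewrite /= mulN1r.
under [X in _ + _ * X <= _]eq_Rintegral => x _ do rewrite subrr normr0.
by rewrite !Rintegral_cst// !mul0r mulr0 addr0.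
Qed.

Lemma cost0 : cost 0 0.
Proof. by have := cost_diag A0; rewrite oppr0. Qed.

Lemma costD w1 w2 c1 c2 : cost w1 c1 -> cost w2 c2 -> cost (w1 + w2) (c1 + c2).
Proof.
move=> [u1 [p1 [Au1 ip1 s1 i1 h1]]] [u2 [p2 [Au2 ip2 s2 i2 h2]]].
have iu1 := integrable_A Au1; have iu2 := integrable_A Au2.
exists (u1 + u2), (fun x => p1 x + p2 x); split.
- by have := ALin 1 Au1 Au2; rewrite scale1r.
- exact: integrable1D.
- move=> x; rewrite (_ : _ + _ = (w1.1 x + u1) + (w2.1 x + u2)).
    exact: slope_leD.
  by rewrite addrACA.
- exact: integrable1D.
apply: le_trans (lerD h1 h2); rewrite addrACA -mulrDr RintegralD// lerD2l.
rewrite ler_pM2l// -RintegralD//; last 2 first.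
- by apply: integrable1_norm; exact: integrable1B.
- by apply: integrable1_norm; exact: integrable1B.
apply: le_Rintegral => //.
- by apply: integrable1_norm; apply: integrable1B; exact: integrable1D.
- by apply: integrable1D; apply: integrable1_norm; exact: integrable1B.
move=> x _.
change (`|(w1.2 x + w2.2 x) - (u1 x + u2 x)| <= `|w1.2 x - u1 x| + `|w2.2 x - u2 x|).
by rewrite opprD addrACA ler_normD.
Qed.

Lemma costZ a w c : cost w c -> cost (a *: w) (`|a| * c).
Proof.
move=> [u [p [Au ip s i h]]].
have iu := integrable_A Au.
exists (a *: u), (fun x => `|a| * p x); split.
- by have := ALin a Au A0; rewrite addr0.
- exact: integrable1Z.
- move=> x; rewrite (_ : _ + _ = a *: (w.1 x + u)); first exact: slope_leZ.
  by rewrite scalerDr.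
- exact: integrable1Z.
apply: le_trans (ler_wpM2l (normr_ge0 a) h).
rewrite mulrDr RintegralZl// lerD2l mulrCA ler_pM2l// -RintegralZl//; last first.
  by apply: integrable1_norm; exact: integrable1B.
rewrite le_eqVlt; apply/orP; left; apply/eqP; apply: eq_Rintegral => x _.
by rewrite -normrM mulrBr.
Qed.

(** This provides the domination that [riesz_weighted] asks for, with weight [slope u]. *)
Lemma cost_field u (h : borel X -> R) : A u -> weighted_L1 m (slope u) h ->
  cost (fun x => h x *: u, 0) (\int[m]_x (`|h x| * slope u x)).
Proof.
move=> Au [mh ih]; apply: cost_form.
  apply: eq_integrable (integrable1_norm ih) => // x _.
  by rewrite /= normrM (ger0_norm (slope_ge0 _ _)).
by move=> x; apply: slope_leZ; exact: slope_slope_le.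
Qed.

Lemma weighted_L1_A u v : A u -> A v -> weighted_L1 m (slope u) v.
Proof.
move=> Au Av; have [M vM] := bounded_A Av.
exact: (weighted_L1_bounded (integrable_slope Au) (measurable_A Av) vM).
Qed.

Lemma weighted_L1_indicM (phi h : borel X -> R) E : measurable E ->
  weighted_L1 m phi h -> measurable_fun setT phi ->
  weighted_L1 m phi (fun x => \1_E x * h x).
Proof.
move=> mE [mh ih] mphi; have m1 : measurable_fun setT (\1_E : borel X -> R).
  exact: measurable_indic.
split; first exact: measurable_funM.
apply: le_integrable ih => //.
  by apply/measurable_EFinP; do 2 apply: measurable_funM => //.
move=> x _ /=; rewrite lee_fin -mulrA normrM indicE.
by case: (_ \in _); rewrite ?normr1 ?mul1r// normr0 mul0r.
Qed.

Lemma cost_formD a om1 om2 c d : cost (om1, 0) c -> cost (om2, 0) d ->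
  cost (a *: om1 + om2, 0) (`|a| * c + d).
Proof.
move=> h1 h2; have := costD (costZ a h1) h2.
change (a *: (om1, 0) + (om2, 0) : (X -> X -> R) * (X -> R))
  with (a *: om1 + om2, a *: 0 + 0 : X -> R).
by rewrite scaler0 addr0.
Qed.

(** The last clause says that minus the integral of [f * D] is at least the infimum $q_\lambda(f)$;
    a margin [e] is allowed since the infimum may not be attained. *)
Lemma duality f : integrable1 f -> exists b (D : borel X -> R),
  [/\ Der m A b, der_bound m A b (cst 1), is_div m A b D,
    integrable1 (f \* D) &
    forall e, 0 < e -> exists u, A u /\
      \int[m]_x slope u x + lam * \int[m]_x `|f x - u x| <= - (\int[m]_x (f x * D x)) + e].
Proof.
move=> If.
have [Lam [linL leL Lf]] := hahn_banach_gauge cost_ge0 cost0 costD costZ (cost_L1 If).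
have LamD a om1 om2 c d : cost (om1, 0) c -> cost (om2, 0) d ->
    Lam (a *: om1 + om2, 0) = a * Lam (om1, 0) + Lam (om2, 0).
  move=> h1 h2; rewrite -(linL _ _ _ _ _ h1 h2); congr Lam.
  change ((a *: om1 + om2, 0) = (a *: om1 + om2, a *: 0 + 0) :> (X -> X -> R) * (X -> R)).
  by rewrite scaler0 addr0.
have LamD2 a v1 v2 : integrable1 v1 -> integrable1 v2 ->
    Lam (0, a *: v1 + v2) = a * Lam (0, v1) + Lam (0, v2).
  move=> h1 h2; rewrite -(linL _ _ _ _ _ (cost_L1 h1) (cost_L1 h2)); congr Lam.
  change ((0, a *: v1 + v2) = (a *: 0 + 0, a *: v1 + v2) :> (X -> X -> R) * (X -> R)).
  by rewrite scaler0 addr0.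
have Lam_diag u : A u -> Lam (fun=> u, 0) = Lam (0, u).
  move=> Au; apply/eqP; rewrite -subr_eq0 -normr_le0.
  have := leL _ _ (cost_diag Au); apply: le_trans.
  have Lu := cost_L1 (integrable_A Au).
  have Cu := cost_form (integrable_slope Au) (fun x => slope_slope_le x Au).
  have H := linL (-1) _ _ _ _ Lu Cu; rewrite mulN1r in H; rewrite addrC -H.
  rewrite le_eqVlt; apply/orP; left; apply/eqP; congr (`|Lam _|).
  change ((-1 *: 0 + (fun=> u), -1 *: u + 0) = (fun=> u, - u) :> (X -> X -> R) * (X -> R)).
  by rewrite scaler0 add0r scaleN1r addr0.
(* Riesz representation with the constant weight [lam], for which the weighted space is $L^1$
   itself. *)
have [g [ig glam gE]] : exists g : borel X -> R,
  [/\ integrable1 g, forall x, `|g x| <= lam &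
      forall v, integrable1 v -> Lam (0, v) = \int[m]_x (v x * g x)].
  have wi v : weighted_L1 m (cst lam) v -> integrable1 v.
    move=> [mv iv]; apply: eq_integrable (integrable1Z lam^-1 iv) => // x _ /=.
    by rewrite mulrCA mulVf ?mulr1// gt_eqF.
  have ilam : integrable1 (cst lam) by exact: finite_measure_integrable_cst.
  have [||g [ig gl gE]] := @riesz_weighted _ _ _ m (cst lam) (fun=> ltW lam0) ilam
    (fun v => Lam (0, v)).
  - by move=> a h k /wi ih /wi ik; exact: LamD2.
  - move=> v /wi iv; rewrite RintegralZr//; last exact: integrable1_norm.
    by rewrite mulrC; exact: leL (cost_L1 iv).
  exists g; split => // v iv; apply: gE; split.
    exact: integrable1_measurable iv.
  apply: eq_integrable (integrable1Z lam iv) => // x _.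
  by rewrite /= mulrC.
(* For each [u] in [A] separately, Riesz representation with weight [slope u] of the functional
   [h => Lam (h u, 0)]; the values of [b] outside [A] are arbitrary. *)
have [b bP] : exists b : (X -> R) -> X -> R, forall u, A u ->
  [/\ integrable1 (b u), forall x, `|b u x| <= slope u x &
      forall h, weighted_L1 m (slope u) h ->
        Lam (fun x => h x *: u, 0) = \int[m]_x (h x * b u x)].
  suff H u : exists bu : X -> R, A u -> [/\ integrable1 bu,
      forall x, `|bu x| <= slope u x & forall h, weighted_L1 m (slope u) h ->
        Lam (fun x => h x *: u, 0) = \int[m]_x (h x * bu x)] by have [b bP] := @boolp.choice _ _ _ H; exists b.
  have [Au|nAu] := pselect (A u); last by exists u.
  have [||bu [ibu bul buE]] := @riesz_weighted _ _ _ m (slope u) (slope_ge0 u)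
    (integrable_slope Au) (fun h => Lam (fun x => h x *: u, 0)).
  - move=> a h k Wh Wk; rewrite -(LamD _ _ _ _ _ (cost_field Au Wh) (cost_field Au Wk)).
    congr (Lam (_, _)); apply/funext => x.
    change ((a * h x + k x) *: u = a *: (h x *: u) + k x *: u).
    by rewrite scalerDl scalerA.
  - by move=> h Wh; exact: leL (cost_field Au Wh).
  by exists bu.
have W1 u E : A u -> measurable E -> weighted_L1 m (slope u) (\1_E : borel X -> R).
  move=> Au mE; apply: weighted_L1_indic => //; exact: integrable_slope.
have mb u : A u -> measurable_fun [set: borel X] (b u : borel X -> R).
  by move=> Au; have [ib _ _] := bP _ Au; exact: integrable1_measurable ib.
have ivb u v : A u -> A v -> integrable1 (fun x => u x * b v x).
  move=> Au Av; have [ib bl bE] := bP _ Av; have [M uM] := bounded_A Au.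
  exact: (integrable1_mulr_bounded ib (measurable_A Au) uM).
have i1 E (p : borel X -> R) : measurable E -> integrable1 p -> integrable1 (fun x => \1_E x * p x).
  move=> mE ip; apply: (integrable1_mulr_bounded (c := 1) ip (measurable_indic mE)).
  by move=> x; rewrite indicE; case: (_ \in _); rewrite ?normr1 ?normr0.
have bnd : der_bound m A b (cst 1).
  split.
  - by apply: (@ess_bounded_Lfun _ _ _ _ _ 1) => // x; rewrite normr1.
  - exact: nearW.
  - move=> u Au; apply: nearW => x; rewrite mul1e -EFin_slope// lee_fin.
    by have [_ + _] := bP _ Au; exact.
have mg : measurable_fun [set: borel X] g by exact: integrable1_measurable ig.
have ivg v : integrable1 v -> integrable1 (fun x => v x * g x).
  move=> iv; apply: eq_integrable (integrable1_mulr_bounded iv mg glam) => // x _.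
  by rewrite /= mulrC.
have ivN v : integrable1 v -> integrable1 (fun x => v x * - g x).
  move=> /ivg/(integrable1Z (-1)); apply: eq_integrable => // x _.
  by rewrite /= mulrN mulN1r.
have ivNE v : integrable1 v -> \int[m]_x (v x * - g x) = - \int[m]_x (v x * g x).
  move=> /ivg iv; rewrite -mulN1r -RintegralZl//.
  by apply: eq_Rintegral => x _; rewrite mulrN mulN1r.
exists b, (fun x => - g x); split => //.
- split.
  + by move=> u Au; apply/Lfun1_integrable; have [] := bP _ Au.
  + move=> a u v Au Av; have Auv := ALin a Au Av.
    have [iu _ uE] := bP _ Au; have [iv _ vE] := bP _ Av.
    have [iuv _ uvE] := bP _ Auv.
    apply: ae_eq_Rintegral_indic => //; first by apply: integrable1D => //; exact: integrable1Z.
    move=> E mE; rewrite -uvE; last exact: W1.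
    rewrite (@eq_Rintegral _ _ _ m setT (fun x => a * (\1_E x * b u x) + \1_E x * b v x)); last first.
      move=> x _; change (\1_E x * (a * b u x + b v x) = a * (\1_E x * b u x) + \1_E x * b v x).
      by rewrite mulrDr mulrCA.
    rewrite RintegralD//; [|by apply: integrable1Z; exact: i1|exact: i1].
    rewrite RintegralZl//; last exact: i1.
    rewrite -uE; last exact: W1.
    rewrite -vE; last exact: W1.
    rewrite -(LamD _ _ _ _ _ (cost_field Au (W1 _ _ Au mE)) (cost_field Av (W1 _ _ Av mE))).
    congr (Lam (_, _)); apply/funext => x.
    change (\1_E x *: (a *: u + v) = a *: (\1_E x *: u) + \1_E x *: v).
    by rewrite scalerDr !scalerA mulrC.
  + move=> u v Au Av; have Auv := AM Au Av.
    have [iu _ uE] := bP _ Au; have [iv _ vE] := bP _ Av.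
    have [iuv _ uvE] := bP _ Auv.
    have mS w : A w -> measurable_fun [set: borel X] (slope w : borel X -> R).
      by move=> Aw; exact: integrable1_measurable (integrable_slope Aw).
    apply: ae_eq_Rintegral_indic => //; first by apply: integrable1D; exact: ivb.
    move=> E mE; rewrite -uvE; last exact: W1.
    rewrite (@eq_Rintegral _ _ _ m setT (fun x => (\1_E x * u x) * b v x + (\1_E x * v x) * b u x)); last first.
      move=> x _; change (\1_E x * (u x * b v x + v x * b u x) =
        (\1_E x * u x) * b v x + (\1_E x * v x) * b u x).
      by rewrite mulrDr !mulrA.
    have Wu := weighted_L1_indicM mE (weighted_L1_A Av Au) (mS _ Av).
    have Wv := weighted_L1_indicM mE (weighted_L1_A Au Av) (mS _ Au).
    have Euv := vE _ Wu; have Evu := uE _ Wv.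
    rewrite RintegralD//; last 2 first.
    * apply: eq_integrable (i1 _ _ mE (ivb _ _ Au Av)) => // x _.
      by rewrite /= mulrA.
    * apply: eq_integrable (i1 _ _ mE (ivb _ _ Av Au)) => // x _.
      by rewrite /= mulrA.
    rewrite -Euv -Evu.
    (* The Leibniz remainder with coefficients frozen at the base point [x]. Its slope at [x] is 0,
       so the field costs nothing and [Lam] kills it. *)
    pose rem (x : X) := \1_E x *: (u * v - u x *: v - v x *: u) : X -> R.
    have Crem : cost (rem, 0) 0.
      have i0 : integrable1 (cst 0) by exact: (integrable_A A0).
      have := @cost_form rem (cst 0) i0.
      rewrite Rintegral_cst// mul0r; apply => x.
      have := slope_leZ (\1_E x) (slope_le_leibniz (slope_slope_le x Au) (slope_slope_le x Av)).
      by rewrite mulr0.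
    have Lrem : Lam (rem, 0) = 0.
      by apply/eqP; rewrite -normr_le0; exact: leL Crem.
    have Cu := cost_field Av Wu; have Cv := cost_field Au Wv.
    have split3 (V : zmodType) (a p q : V) : a = p + (q + (a - p - q)).
      by rewrite [q + _]addrC subrK addrC subrK.
    have -> : Lam (fun x => \1_E x *: (u * v), 0) =
        1 * Lam (fun x => (\1_E x * u x) *: v, 0) +
        (1 * Lam (fun x => (\1_E x * v x) *: u, 0) + Lam (rem, 0)).
      rewrite -(LamD _ _ _ _ _ Cv Crem) -(LamD _ _ _ _ _ Cu (cost_formD 1 Cv Crem)).
      congr (Lam (_, _)); apply/funext => x; rewrite !scale1r.
      change (\1_E x *: (u * v) = (\1_E x * u x) *: v + ((\1_E x * v x) *: u +
        \1_E x *: (u * v - u x *: v - v x *: u))).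
      by rewrite 2!scalerBr !scalerA -split3.
    by rewrite Lrem addr0 !mul1r.
  + by exists (cst 1).
- split.
    apply: (@ess_bounded_Lfun _ _ _ _ _ lam); last by move=> x; rewrite normrN.
    by apply: measurable_funN.
  move=> u Au; have [ib _ uE] := bP _ Au; rewrite EFin_Rintegral//.
  rewrite EFin_Rintegral; last exact: (ivN _ (integrable_A Au)).
  rewrite ivNE; last exact: integrable_A.
  rewrite -EFinN opprK; congr EFin.
  rewrite -gE; last exact: integrable_A.
  (* The constant field [u] is the field [h u] with [h = 1], so [Lam] evaluates on it to the
     integral of [b u]. *)
  rewrite -Lam_diag// (_ : (fun=> u) = fun x : X => (cst 1 : X -> R) x *: u); last first.
    by apply/funext => x; rewrite scale1r.
  rewrite uE; first by apply: eq_Rintegral => x _; rewrite mul1r.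
  apply: (weighted_L1_bounded (integrable_slope Au) (c := 1)) => // x.
  by rewrite normr1.
- exact: ivN.
move=> e e0; rewrite ivNE// opprK -gE// Lf.
have [|c [u [phi [Au iphi sphi _ uc]]] ce] := @inf_adherent _ [set c | cost (0, f) c] _ e0.
  split; first by exists (lam * \int[m]_x `|f x|); exact: cost_L1.
  by exists 0 => c; exact: cost_ge0.
exists u; split => //; apply: le_trans (ltW ce); apply: le_trans uc.
(* With zero field, the majorant [phi] of the competitor dominates the slope of [u] pointwise. *)
rewrite lerD2r; apply: le_Rintegral => //; first exact: integrable_slope.
move=> x _; rewrite -lee_fin EFin_slope//.
by have := slope_le_lip_a (sphi x); rewrite /= add0r.
Qed.

End duality.

(** * The main inequality *)

Section modulus.
Context {R : realType} {X : pmetricType R}.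
Variable m : {finite_measure set (borel X) -> \bar R}.
Variable A : set (X -> R).
Hypothesis AL : A `<=` LIP_star m.
Variable b : (X -> R) -> X -> R.

#[local] Instance ae_filter_borel : Filter (nbhs (almost_everywhere m)) :=
  ae_filter_ringOfSetsType m.

(** The competitors for the modulus, normalised to take values in $[0,1]$ at every point; on a
    finite measure space they are all integrable. *)
Let bounded_by_one (G : X -> R) :=
  [/\ measurable_fun [set: borel X] (G : borel X -> R), forall x, 0 <= G x <= 1 &
      forall f, A f -> \forall x \ae m, `|b f x| <= G x * slope f x].

Let norm_le1 G x : bounded_by_one G -> `|G x| <= 1.
Proof. by move=> [_ /(_ x)/andP[G0 G1] _]; rewrite ger0_norm. Qed.

Let integrable_le1 G : bounded_by_one G ->
  m.-integrable [set: borel X] (EFin \o (G : borel X -> R)).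
Proof.
move=> PG; have [mG _ _] := PG.
exact: (integrable1_bounded m mG (fun x => norm_le1 x PG)).
Qed.

Let bound_le1 G : bounded_by_one G -> der_bound m A b G.
Proof.
move=> PG; have [mG G01 Gb] := PG; split.
- exact: (ess_bounded_Lfun m mG (fun x => norm_le1 x PG)).
- by apply: nearW => x; have /andP[] := G01 x.
- move=> f Af; apply: filterS (Gb f Af) => x.
  by rewrite -(EFin_slope AL)// -EFinM lee_fin.
Qed.

Let clamp G' : der_bound m A b (cst 1) -> der_bound m A b G' ->
  bounded_by_one (fun x => Num.max 0 (Num.min (G' x) 1)).
Proof.
move=> [_ _ b1] [/Lfun_measurable mG' G'0 bG']; split.
- by apply: measurable_maxr => //; exact: measurable_minr.
- by move=> x; rewrite le_max lexx/= ge_max ler01 ge_min lexx orbT.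
- move=> f Af; apply: filterS3 (b1 f Af) (bG' f Af) G'0 => x.
  rewrite -(EFin_slope AL)// mul1e -EFinM !lee_fin => h1 h2 G'0.
  rewrite (max_idPr _); last by rewrite le_min G'0 ler01.
  by rewrite /Num.min; case: ifP; rewrite ?mul1r.
Qed.

Let bounded_min G G' : bounded_by_one G -> bounded_by_one G' ->
  bounded_by_one (fun x => Num.min (G x) (G' x)).
Proof.
move=> [mG G01 bG] [mG' G'01 bG']; split.
- exact: measurable_minr.
- move=> x; have /andP[h1 h2] := G01 x; have /andP[h3 h4] := G'01 x.
  by rewrite le_min h1 h3/= ge_min h2.
- move=> f Af; apply: filterS2 (bG f Af) (bG' f Af) => x h1 h2.
  by rewrite /Num.min; case: ifP.
Qed.

(** The integral is minimised among competitors: the pointwise infimum of a minimising sequence is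
    again a competitor and attains the minimum. *)
Lemma der_modulus_exists : der_bound m A b (cst 1) ->
  exists G, der_modulus m A b G /\ forall x, 0 <= G x <= 1.
Proof.
move=> b1.
pose S := [set \int[m]_x G x | G in bounded_by_one].
have P1 : bounded_by_one (cst 1).
  split; first exact: measurable_cst.
    by move=> x; rewrite ler01 lexx.
  move=> f Af; have [_ _ /(_ f Af)] := b1; apply: filterS => x.
  by rewrite -(EFin_slope AL)// mul1e mul1r lee_fin.
have SI : has_inf S.
  split; first by exists (\int[m]_x (cst 1 : X -> R) x), (cst 1).
  exists 0 => _ [G [_ G01 _] <-]; apply: Rintegral_ge0 => x _.
  by have /andP[] := G01 x.
have leS G : bounded_by_one G -> inf S <= \int[m]_x G x.
  by move=> PG; apply: ge_inf; [exact: SI.2|exists G].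
have /(@boolp.choice _ _ _)[Gn GnP] n : exists G, bounded_by_one G /\
    \int[m]_x G x < inf S + n.+1%:R^-1.
  have [_ [G PG <-] ltG] : exists2 x, S x & x < inf S + n.+1%:R^-1.
    by apply: inf_adherent; rewrite // invr_gt0.
  by exists G.
pose G x := infs (Gn ^~ x) 0%N.
have Gn0 n x : 0 <= Gn n x by have [[_ /(_ x)/andP[]]] := GnP n.
have GleGn n x : G x <= Gn n x.
  by apply: ge_inf; [exists 0 => _ [k _ <-]|exists n].
have leG x c : (forall n, c <= Gn n x) -> c <= G x.
  by move=> H; apply: lb_le_inf; [exists (Gn 0%N x), 0%N|move=> _ [k _ <-]].
have PG : bounded_by_one G.
  split.
  - apply: measurable_fun_infs => [x _|n]; last by have [[]] := GnP n.
    by exists 0 => _ [k _ <-].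
  - move=> x; rewrite leG//= (le_trans (GleGn 0%N x))//.
    by have [[_ /(_ x)/andP[]]] := GnP 0%N.
  - move=> f Af; have : forall n, \forall x \ae m, `|b f x| <= Gn n x * slope f x.
      by move=> n; have [[_ _ /(_ f Af)]] := GnP n.
    move/ae_foralln; apply: filterS => x H.
    (* Where the slope vanishes, one index already gives [b f x = 0]; elsewhere dividing by the
       slope turns the inequalities into a lower bound for all [Gn n x]. *)
    have := slope_ge0 f x; rewrite le_eqVlt => /predU1P[s0|s0].
      by have := H 0%N; rewrite -s0 !mulr0.
    rewrite -ler_pdivrMr//; apply: (leG _ _) => n.
    by rewrite ler_pdivrMr.
have GS : \int[m]_x G x <= inf S.
  rewrite leNgt; apply/negP => /ltr_add_invr[k].
  apply/negP; rewrite -leNgt; apply: le_trans (ltW (GnP k).2).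
  apply: le_Rintegral => //; first exact: integrable_le1.
  by apply: integrable_le1; have [] := GnP k.
exists G; split; last by have [] := PG.
split; first exact: bound_le1.
move=> G' bG'.
(* [H] is a competitor below [G]; as its integral cannot be smaller, [H = G] a.e., and [H <= G']
   wherever [G'] is nonnegative. *)
pose H x := Num.min (G x) (Num.max 0 (Num.min (G' x) 1)).
have PH : bounded_by_one H by apply: bounded_min => //; exact: clamp.
have HG x : H x <= G x by rewrite /H ge_min lexx.
have iGH : m.-integrable [set: borel X] (EFin \o (fun x : borel X => G x - H x)).
  by apply: integrable1B; exact: integrable_le1.
have : ae_eq m [set: borel X] (EFin \o (fun x : borel X => G x - H x)) (cst 0%E).
  apply/ae_eq_integral_abs => //; first exact: measurable_int iGH.
  under eq_integral => x _ do rewrite /= ger0_norm ?subr_ge0//.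
  rewrite EFin_Rintegral//; congr EFin.
  apply/eqP; rewrite eq_le; apply/andP; split; last first.
    by apply: Rintegral_ge0 => x _; rewrite subr_ge0.
  rewrite RintegralB//; [|exact: integrable_le1..].
  by rewrite subr_le0 (le_trans GS)// leS.
have [_ G'0 _] := bG'; apply: filterS2 G'0 => x G'x /(_ I)[/eqP].
rewrite subr_eq0 => /eqP ->; rewrite /H ge_min; apply/orP; right.
by rewrite ge_max G'x ge_min lexx.
Qed.

End modulus.

(** * Approximating sequences with controlled energy *)

Section approximation.
Context {R : realType} {X : pmetricType R}.
Variable m : {finite_measure set (borel X) -> \bar R}.
Variable A : set (X -> R).
Hypothesis AL : A `<=` LIP_star m.
Hypothesis subalgA : unital_subalgebra A.
Variables (f : X -> R) (L : ((X -> R) -> X -> R) -> {charge set (borel X) -> \bar R}).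
Hypothesis If : f \in Lfun m 1.
Hypothesis hL : BV_W_op m A f L.

Lemma tvar_le_total_variation b G : Der_div m A b -> der_modulus m A b G ->
  (\forall x \ae m, G x <= 1) -> (tvar (L b) setT <= total_variation_W m A L setT)%E.
Proof.
move=> Db bG G1; apply: ereal_sup_ubound.
(* The trivial partition of the space: one full piece, then empty ones, all measured by the same
   variation. *)
pose F n : set (borel X) := if n is 0%N then setT else set0.
have FT : \bigcup_n F n = setT by apply/seteqP; split => // x _; exists 0%N.
have mF n : measurable (F n) by case: n => [|n]; [exact: measurableT|exact: measurable0].
have tF : trivIset setT F by move=> [|i] [|j] _ _ // [x []].
exists (fun=> tvar (L b)), F; split => //; first by exists b, G.
have H := @measure_semi_sigma_additive _ _ _
  (charge_variation (svalP (hahn_sig (L b)))) F mF tF (bigcupT_measurable _ mF).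
by rewrite FT in H; apply/esym/cvg_lim.
Qed.

(** Of the two energy bounds, the real one comes from the boundedness of [L] and gives membership in
    [BV_H]; the other gives the inequality of norms. *)
Lemma approximating_sequence : exists C : R, forall e, 0 < e ->
  exists u : nat -> X -> R, [/\ forall n, A (u n), cvg_L1 m u f,
    forall n, (\int[m]_x lip_a (u n) x <= (C + e)%:E)%E &
    forall n, (\int[m]_x lip_a (u n) x <= total_variation_W m A L setT + e%:E)%E].
Proof.
have [[A0 ALin] [_ AM]] := subalgA.
have {}A0 : A 0 by exact: set_mem.
have {}ALin a u v : A u -> A v -> A (a *: u + v).
  by move=> Au Av; apply: set_mem; apply: ALin; exact: mem_set.
have {}AM u v : A u -> A v -> A (u * v).
  by move=> Au Av; apply: set_mem; apply: AM; exact: mem_set.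
have iF : m.-integrable [set: borel X] (EFin \o f) by exact/Lfun1_integrable.
have [_ _ [C LC] LP] := hL.
(* The absolute value keeps the bound monotone in the norm of the modulus, as [C] carries no sign
   condition. *)
exists `|C| => e e0.
have /(@boolp.choice _ _ _)[u uP] n : exists u, [/\ A u,
    \int[m]_x slope u x + n.+1%:R * \int[m]_x `|f x - u x| <= `|C| + e &
    ((\int[m]_x slope u x)%:E <= total_variation_W m A L setT + e%:E)%E].
  (* Duality is used with $\lambda = n + 1$, so the derivation depends on [n] while the bounds below
     do not. *)
  have [b [D [Db b1 bD ifD bu]]] := duality AL A0 ALin AM (ltr0Sn R n) iF.
  have [G [bG G01]] := der_modulus_exists AL b1.
  have Ddb : Der_div m A b by split => //; exists D.
  have G1 : \forall x \ae m, G x <= 1.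
    by apply: nearW => x; have /andP[] := G01 x.
  have [u [Au ule]] := bu e e0.
  set s := - (\int[m]_x (f x * D x)) in ule.
  have sL : (s%:E <= tvar (L b) setT)%E.
    have [/(_ D bD) Ls _ _] := LP b Ddb.
    have -> : s%:E = L b setT by rewrite Ls EFin_Rintegral// -EFinN.
    apply: le_trans (lee_abs _) _; exact: abse_charge_variation.
  have sC : s <= `|C|.
    rewrite -lee_fin; apply: le_trans sL _; apply: le_trans (LC b G Ddb bG) _.
    have N1 : ('N[m]_+oo[EFin \o (G : borel X -> R)] <= 1%:E)%E.
      apply: Lfunoo_norm_le => //; apply: nearW => x.
      by have /andP[G0 G1'] := G01 x; rewrite ger0_norm.
    apply: (@le_trans _ _ (`|C|%:E * 'N[m]_+oo[EFin \o (G : borel X -> R)])%E).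
      by apply: lee_wpmul2r; [exact: Lnorm_ge0|rewrite lee_fin ler_norm].
    by rewrite -[leRHS]mule1; apply: lee_wpmul2l.
  have p0 : 0 <= n.+1%:R * \int[m]_x `|f x - u x|.
    by apply: mulr_ge0 => //; exact: Rintegral_ge0.
  exists u; split => //; first by apply: le_trans ule _; rewrite lerD2r.
  apply: (@le_trans _ _ (s + e)%:E).
    by rewrite lee_fin; apply: le_trans ule; rewrite lerDl.
  rewrite EFinD leeD2r//; apply: le_trans sL _.
  exact: tvar_le_total_variation bG G1.
have lipE n : (\int[m]_x lip_a (u n) x = (\int[m]_x slope (u n) x)%:E)%E.
  have [Au _ _] := uP n; rewrite -EFin_Rintegral; last exact: (integrable_slope AL Au).
  by apply: eq_integral => x _; rewrite (EFin_slope AL).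
have n0 n : 0 <= \int[m]_x `|f x - u n x| by exact: Rintegral_ge0.
have s0 n : 0 <= \int[m]_x slope (u n) x.
  by apply: Rintegral_ge0 => x _; exact: slope_ge0.
exists u; split => //.
- by move=> n; have [] := uP n.
- have ifu n : m.-integrable [set: borel X] (EFin \o (fun x : borel X => `|f x - u n x|)).
    apply: integrable1_norm; apply: integrable1B => //.
    by have [Au _ _] := uP n; exact: (integrable_A AL Au).
  have NE n : ('N[m]_1[EFin \o (u n \- f)%R] = (\int[m]_x `|f x - u n x|)%:E)%E.
    rewrite Lnorm1 -EFin_Rintegral//; apply: eq_integral => x _.
    by rewrite /= distrC.
  rewrite /cvg_L1; under eq_fun do rewrite NE.
  apply: cvg_EFin; first exact: nearW.
  (* The penalty term, [n + 1] times the $L^1$ distance, stays below [|C| + e]. *)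
  apply: (@squeeze_cvgr _ _ _ _ (cst 0) (fun n => (`|C| + e) * n.+1%:R^-1)).
  + apply: nearW => n; rewrite n0/= ler_pdivlMr// mulrC.
    by have [_ h _] := uP n; apply: le_trans h; rewrite lerDr.
  + exact: cvg_cst.
  + rewrite -[X in _ --> X](mulr0 (`|C| + e)); apply: cvgMr.
    exact: cvg_harmonic.
- move=> n; rewrite lipE lee_fin; have [_ h _] := uP n.
  by apply: le_trans h; rewrite lerDl mulr_ge0.
- by move=> n; rewrite lipE; have [] := uP n.
Qed.

End approximation.

Theorem theorem4p8 (R : realType) (X : pmetricType R)
    (m : {finite_measure set (borel X) -> \bar R})
    (A : set (X -> R)) :
  radon m ->
  A `<=` LIP_star m -> unital_subalgebra A -> separating A ->
  BV_W m A `<=` BV_H m A /\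
  (forall (f : X -> R)
      (L : ((X -> R) -> X -> R) -> {charge set (borel X) -> \bar R}),
    f \in Lfun m 1 -> BV_W_op m A f L ->
    (BV_H_norm m A f <= total_variation_W m A L setT)%E).
Proof.
move=> _ AL subA _; split=> [f [If [L hL]]|f L If hL];
  have [C approx] := approximating_sequence AL subA If hL.
  split => //; have [u [Au uf uC _]] := approx 1 ltr01; exists u; split => //.
  apply: (@le_lt_trans _ _ (C + 1)%:E); last by rewrite ltry.
  by apply: ge_ereal_sup => _ [n _ <-].
apply/lee_addgt0Pr => e e0; have [u [Au uf _ uTV]] := approx e e0.
apply: (@le_trans _ _ (limn_einf (fun n => \int[m]_x lip_a (u n) x)%E)).
  by apply: ereal_inf_lbound; exists u.
(* Each tail infimum is at most its first term, which is bounded by the total variation plus [e]. *)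
rewrite limn_einf_lim; apply: lime_le; first exact: is_cvg_einfs.
apply: nearW => n; apply: le_trans (uTV n).
by apply: ereal_inf_lbound; exists n => /=.
Qed.
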